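(* The decision version of SMC-1 (given an instance and an integer $b$, decide whether there is a feasible matching with at most $b$ blocking pairs) is $\mathsf{NP}$-hard, even when restricted to instances with $\Delta_{\mathcal W}=2$ and $\Delta_{\mathcal M}=3$.
   Context: An instance of Stable Marriage with Covering Constraints (SMC) consists of a finite set $\mathcal M$ of men, a finite set $\mathcal W$ of women, for each person $x$ a preference list $L(x)$ strictly ordering a subset of the opposite sex (the persons acceptable to $x$), and subsets $\mathcal W^\star\subseteq\mathcal W$, $\mathcal M^\star\subseteq\mathcal M$ of distinguished persons. A matching is a set of disjoint man–woman pairs $\{m,w\}$ with $m$ and $w$ in each other's lists; $M(x)$ denotes the partner of $x$. A pair $\{m,w\}$ of mutually acceptable persons is blocking for $M$ if $m$ is unmatched or prefers $w$ to $M(m)$, and $w$ is unmatched or prefers $m$ to $M(w)$. A matching is feasible if it matches every person in $\mathcal W^\star\cup\mathcal M^\star$. SMC-1 is the special case $\mathcal M^\star=\emptyset$. $\Delta_{\mathcal M}$ and $\Delta_{\mathcal W}$ denote the maximum length of the preference list of a man and of a woman, respectively. *)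

(* Defs.v *)
From mathcomp Require Import all_boot.

Set Implicit Arguments.
Unset Strict Implicit.
Unset Printing Implicit Defensive.

(** * Stable marriage with covering constraints *)

(* The lists need not be symmetric: m may list w without w listing m. *)
Record smc (M W : finType) := Smc {
  mlist : M -> seq W;  (* most preferred first *)
  wlist : W -> seq M;
  mlist_uniq : forall m, uniq (mlist m);
  wlist_uniq : forall w, uniq (wlist w);
  mstar : {set M};
  wstar : {set W} }.

Section Matching.
Variables (M W : finType) (P : smc M W).
Implicit Types (mu : {set M * W}) (m : M) (w : W).

Definition acceptable m w := (w \in mlist P m) && (m \in wlist P w).

Definition matching mu : Prop :=
  (forall m w, (m, w) \in mu -> acceptable m w) /\
  (forall p q, p \in mu -> q \in mu -> p.1 = q.1 \/ p.2 = q.2 -> p = q).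

Definition mpartner mu m : option W := [pick w | (m, w) \in mu].
Definition wpartner mu w : option M := [pick m | (m, w) \in mu].

(* Meaningful when both arguments occur in the list. *)
Definition prefers (T : eqType) (l : seq T) (x y : T) := index x l < index y l.

Definition blocking mu m w : bool :=
  [&& acceptable m w,
      (if mpartner mu m is Some w' then prefers (mlist P m) w w' else true)
    & (if wpartner mu w is Some m' then prefers (wlist P w) m m' else true)].

Definition num_blocking mu := #|[set p : M * W | blocking mu p.1 p.2]|.

Definition feasible mu : Prop :=
  [/\ matching mu,
      forall w, w \in wstar P -> wpartner mu w != None
    & forall m, m \in mstar P -> mpartner mu m != None].

Definition Delta_M := \max_(m : M) size (mlist P m).
Definition Delta_W := \max_(w : W) size (wlist P w).

End Matching.

(* An input of the decision problem.  The persons carry distinct bit strings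
   as names, by which the encoding below refers to them. *)
Record smc_input := SmcInput {
  men : finType;
  women : finType;
  market : smc men women;
  mname : men -> seq bool;
  wname : women -> seq bool;
  mname_inj : injective mname;
  wname_inj : injective wname;
  budget : nat }.

Definition smc_yes (I : smc_input) : Prop :=
  exists mu, feasible (market I) mu /\ num_blocking (market I) mu <= budget I.

(** * Encoding of inputs as bit strings *)

(* Self-delimiting: items are introduced by [true], the end is [false]. *)
Definition enc_seq (T : Type) (e : T -> seq bool) (s : seq T) : seq bool :=
  flatten [seq true :: e x | x <- s] ++ [:: false].

Definition enc_str : seq bool -> seq bool := enc_seq (fun b => [:: b]).

(* Binary numeral, least significant bit first; 0 is written [:: false]. *)
Definition binary (n : nat) : seq bool :=
  [seq odd (n %/ 2 ^ i) | i <- iota 0 (trunc_log 2 n).+1].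

Definition enc_smc (I : smc_input) : seq bool :=
  let P := market I in
  let em m := enc_str (mname m) in
  let ew w := enc_str (wname w) in
  enc_seq (fun m => em m ++ enc_seq ew (mlist P m)) (enum (men I)) ++
  enc_seq (fun w => ew w ++ enc_seq em (wlist P w)) (enum (women I)) ++
  enc_seq em (enum (mstar P)) ++
  enc_seq ew (enum (wstar P)) ++
  enc_str (binary (budget I)).

(** * Deterministic multitape Turing machines *)

Inductive move := MoveL | MoveR | Stay.

Section Tape.
Variable G : Type.

(* None is the blank, Some (inl b) a bit, Some (inr g) an auxiliary symbol. *)
Definition symbol := option (bool + G).

(* A two-way infinite tape.  The head reads the first symbol of the second
   list; the first list is the part to its left, nearest cell first; cells
   beyond either list are blank. *)
Definition tape := (seq symbol * seq symbol)%type.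

Definition read (t : tape) : symbol := head None t.2.

Definition act (t : tape) (sd : symbol * move) : tape :=
  let: (s, d) := sd in
  let: (l, r) := t in
  match d with
  | MoveL => (behead l, head None l :: s :: behead r)
  | MoveR => (s :: l, behead r)
  | Stay => (l, s :: behead r)
  end.

Definition tape_of (x : seq bool) : tape := ([::], [seq Some (inl b) | b <- x]).

Fixpoint leading_bits (r : seq symbol) : seq bool :=
  if r is Some (inl b) :: r' then b :: leading_bits r' else [::].

End Tape.

(* Tape 0 is both input and output tape; [tm_delta] returning None means that
   the machine halts. *)
Record tm := TM {
  tm_aux : finType;
  tm_state : finType;
  tm_ntapes : nat;  (* number of tapes, minus one *)
  tm_start : tm_state;
  tm_delta : tm_state -> {ffun 'I_tm_ntapes.+1 -> symbol tm_aux} ->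
    option (tm_state * {ffun 'I_tm_ntapes.+1 -> symbol tm_aux * move}) }.

Section Run.
Variable A : tm.

Definition config :=
  (tm_state A * {ffun 'I_(tm_ntapes A).+1 -> tape (tm_aux A)})%type.

Definition next (c : config) :
    option (tm_state A * {ffun 'I_(tm_ntapes A).+1 -> symbol (tm_aux A) * move}) :=
  tm_delta c.1 [ffun i => read (c.2 i)].

Definition step (c : config) : config :=
  if next c is Some (q, a) then (q, [ffun i => act (c.2 i) (a i)]) else c.

Definition init (x : seq bool) : config :=
  (tm_start A, [ffun i => if i == ord0 then tape_of _ x else tape_of _ [::]]).

(* The output is the maximal block of bits starting at the head of tape 0. *)
Definition output (c : config) : seq bool := leading_bits (c.2 ord0).2.

Definition computes_within (t : nat) (x y : seq bool) : Prop :=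
  let c := iter t step (init x) in next c = None /\ output c = y.

End Run.

(** * Polynomial time, NP and NP-hardness *)

Definition polytime (f : seq bool -> seq bool) : Prop :=
  exists (A : tm) (c k : nat),
    forall x, computes_within A (c * size x ^ k + c) x (f x).

Definition inP (L : seq bool -> Prop) : Prop :=
  exists f, polytime f /\ forall x, L x <-> f x = [:: true].

(* The input x of the verifier is made self-delimiting, so that enc_str x ++ u
   determines both x and the certificate u. *)
Definition inNP (L : seq bool -> Prop) : Prop :=
  exists (V : seq bool -> Prop) (c k : nat), inP V /\
    forall x, L x <-> exists u, size u <= c * size x ^ k + c /\ V (enc_str x ++ u).

(* NP-hardness, under polynomial-time many-one reductions, of the problem of
   deciding [yes] on the inputs satisfying [class]: every value of the
   reduction is an input from the class. *)
Definition NP_hard (T : Type) (enc : T -> seq bool) (class yes : T -> Prop) : Prop :=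
  forall L, inNP L ->
  exists f : seq bool -> T,
    [/\ polytime (fun x => enc (f x)),
        forall x, class (f x)
      & forall x, L x <-> yes (f x)].

(* Main.v *)
Require Import Defs.
From mathcomp Require Import all_boot.
From mathcomp Require Import zify.
From Stdlib Require Import FunctionalExtensionality.

(** Write a run of the polynomial-time verifier as an N x N tableau whose rows
    are the successive configurations.  Tapes are written relative to their
    heads and every cell also carries the state and the symbols read, so a
    tableau is a tiling of the torus by a finite alphabet subject to a local
    constraint, i.e. an assignment satisfying a CNF formula whose clauses only
    involve variables of neighbouring cells.

    In the marriage instance a variable is a cycle of men and covered women,
    which has exactly two matchings, its truth values.  A clause with [a]
    literals is a path of [a] men and [a - 1] covered women, which leaves
    exactly one man free.  Each literal is an uncovered woman between a man of
    the clause, who likes her best, and a man of the cycle, who desires her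
    exactly when the literal is true.  A clause man not matched to his literal
    forms a blocking pair with her, and so does a cycle man who desires her,
    unless she is matched to the clause man and prefers him.  Hence the free
    man of a clause saves at most two blocking pairs, and saves two iff his
    literal is true and occurs in the clause.  All other costs are the same
    for every feasible matching, so the budget is met iff each clause has a
    true literal.

    The instance is emitted by nested loops over registers holding bit
    strings; a multitape machine keeps each register on a tape, as a stack
    with its top under the head. *)

Set Implicit Arguments.
Unset Strict Implicit.
Unset Printing Implicit Defensive.

(** * Stack programs on Turing machines *)

Definition store := nat -> seq bool.

Definition upd (s : store) r v : store := fun r' => if r' == r then v else s r'.

Lemma upd_same s r v : upd s r v r = v.
Proof. by rewrite /upd eqxx. Qed.

Lemma upd_other s r v r' : r' != r -> upd s r v r' = s r'.
Proof. by rewrite /upd => /negbTE->. Qed.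

Inductive test := Never | NonEmpty | TopTrue.

Definition holds c (v : seq bool) :=
  match c with Never => false | NonEmpty => v != [::] | TopTrue => head false v end.

Inductive com :=
  | Nop
  | Push of nat & bool
  | Pop of nat
  | Seq of com & com
  | Ite of test & nat & com & com
  | While of test & nat & com.

(** The counter is the exact number of machine steps. A push takes two, a move to the left and a
    write; a test takes one, and so does each jump over an else branch or back to the head of a
    loop. *)
Inductive exec : com -> store -> nat -> store -> Prop :=
  | XNop s : exec Nop s 0 s
  | XPush s r b : exec (Push r b) s 2 (upd s r (b :: s r))
  | XPop s r : exec (Pop r) s 1 (upd s r (behead (s r)))
  | XSeq p q s s1 s2 n1 n2 :
      exec p s n1 s1 -> exec q s1 n2 s2 -> exec (Seq p q) s (n1 + n2) s2
  | XIteT c r p q s n s' :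
      holds c (s r) -> exec p s n s' -> exec (Ite c r p q) s n.+2 s'
  | XIteF c r p q s n s' :
      ~~ holds c (s r) -> exec q s n s' -> exec (Ite c r p q) s n.+1 s'
  | XWhileF c r p s : ~~ holds c (s r) -> exec (While c r p) s 1 s
  | XWhileT c r p s s1 s2 n1 n2 :
      holds c (s r) -> exec p s n1 s1 -> exec (While c r p) s1 n2 s2 ->
      exec (While c r p) s (n1.+2 + n2) s2.

(* [IJump c r k] falls through if [c] holds of register [r], else goes to [k]. *)
Inductive instr :=
  | IPush of nat & bool
  | IPop of nat
  | IJump of test & nat & nat.

(** Jump targets are absolute addresses, so the address [base] of the first instruction is passed
    along. [IJump Never] is the unconditional jump. *)
Fixpoint code base p : seq instr :=
  match p with
  | Nop => [::]
  | Push r b => [:: IPush r b]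
  | Pop r => [:: IPop r]
  | Seq p q => code base p ++ code (base + size (code base p)) q
  | Ite c r p q =>
      let cp := code base.+1 p in
      let cq := code (base + size cp).+2 q in
      IJump c r (base + size cp).+2 ::
      cp ++ IJump Never 0 ((base + size cp).+2 + size cq) :: cq
  | While c r p =>
      let cp := code base.+1 p in
      IJump c r (base + size cp).+2 :: cp ++ [:: IJump Never 0 base]
  end.

Definition reg i := match i with IPush r _ => r | IPop r => r | IJump _ r _ => r end.

Section Machine.

Variables (cd : seq instr) (R : nat).
Hypothesis regR : forall i, reg (nth (IPop 0) cd i) <= R.

Definition sees c (x : symbol void) :=
  match c with
  | Never => false
  | NonEmpty => x != None
  | TopTrue => x == Some (inl true)
  end.

Definition on r (f : symbol void -> symbol void * move)
    (rd : {ffun 'I_R.+1 -> symbol void}) :=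
  [ffun i => if i == inord r then f (rd i) else (rd i, Stay)].

(** The state is a program counter with a flag that marks the second half of a push. The machine
    halts when the counter has run off the code. *)
Definition machine_delta (q : 'I_(size cd).+1 * bool) rd :=
  match onth cd q.1 with
  | None => None
  | Some (IPush r b) => Some
      (if q.2 then ((inord q.1.+1, false), on r (fun=> (Some (inl b), Stay)) rd)
       else ((q.1, true), on r (fun x => (x, MoveL)) rd))
  | Some (IPop r) => Some ((inord q.1.+1, false), on r (fun=> (None, MoveR)) rd)
  | Some (IJump c r k) =>
      Some ((inord (if sees c (rd (inord r)) then q.1.+1 else k), false),
            on r (fun x => (x, Stay)) rd)
  end.

Definition machine : tm :=
  @TM void ('I_(size cd).+1 * bool)%type R (ord0, false) machine_delta.

(** Equality up to blanks: a pop leaves a blank to the left of the head, and reading an empty stack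
    may write an explicit blank on the right. *)
Definition rep (t : tape void) (v : seq bool) :=
  (exists j, t.1 = nseq j None) /\
  exists k, t.2 = [seq Some (inl b) | b <- v] ++ nseq k None.

Definition sim (c : config machine) pc (s : store) :=
  [/\ c.1 = (inord pc, false), pc <= size cd & forall i : 'I_R.+1, rep (c.2 i) (s i)].


Lemma rep_read t v : rep t v -> read t = head None [seq Some (inl b) | b <- v].
Proof. by case=> _ [k]; rewrite /read => ->; case: v => //=; case: k. Qed.

Lemma sees_read c t v : rep t v -> sees c (read t) = holds c v.
Proof. by move/rep_read->; case: c v => [] [] // [] v. Qed.

Lemma rep_stay t v : rep t v -> rep (act t (read t, Stay)) v.
Proof.
case: t => l r [[j /= ->] [k /= ->]]; split; first by exists j.
by case: v => [|b v]; [exists k.-1.+1; case: k | exists k].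
Qed.

Lemma rep_push t v b :
  rep t v -> rep (act (act t (read t, MoveL)) (Some (inl b), Stay)) (b :: v).
Proof.
case: t => l r [[j /= ->] [k /= ->]]; split; first by exists j.-1; case: j.
by case: v => [|b' v]; [exists k.-1.+1; case: k | exists k].
Qed.

Lemma rep_pop t v : rep t v -> rep (act t (None, MoveR)) (behead v).
Proof.
case: t => l r [[j /= ->] [k /= ->]]; split; first by exists j.+1.
by case: v => [|b v]; [exists k.-1; case: k | exists k].
Qed.

Lemma sim_push c pc s r b :
  onth cd pc = Some (IPush r b) -> sim c pc s ->
  sim (iter 2 (@step machine) c) pc.+1 (upd s r (b :: s r)).
Proof.
move=> E [c1 pcle reps].
have pclt : pc < size cd by rewrite -onthTE E.
have rR : r <= R by have := regR pc; rewrite (@onth_nth _ (IPop 0) _ _ _ E).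
have s1 : @step machine c = ((inord pc, true),
    [ffun i => act (c.2 i) (on r (fun x => (x, MoveL)) [ffun i => read (c.2 i)] i)]).
  by rewrite /step /Defs.next /= c1 /machine_delta /= inordK // E.
rewrite /= s1 /step /Defs.next /= /machine_delta /= inordK // E /=; split=> //= i.
rewrite !ffunE; case: eqP => [->|/eqP ne].
  by rewrite !inordK // upd_same; apply: rep_push; have := reps (inord r); rewrite inordK.
rewrite upd_other; last by apply: contra ne => /eqP <-; rewrite inord_val.
by apply: rep_stay; apply: rep_stay; apply: reps.
Qed.

Lemma sim_pop c pc s r :
  onth cd pc = Some (IPop r) -> sim c pc s ->
  sim (@step machine c) pc.+1 (upd s r (behead (s r))).
Proof.
move=> E [c1 pcle reps].
have pclt : pc < size cd by rewrite -onthTE E.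
have rR : r <= R by have := regR pc; rewrite (@onth_nth _ (IPop 0) _ _ _ E).
rewrite /step /Defs.next /= c1 /machine_delta /= inordK // E /=; split=> //= i.
rewrite !ffunE; case: eqP => [->|/eqP ne].
  by rewrite !inordK // upd_same; apply: rep_pop; have := reps (inord r); rewrite inordK.
rewrite upd_other; last by apply: contra ne => /eqP <-; rewrite inord_val.
by apply: rep_stay; apply: reps.
Qed.

Lemma sim_jump c pc s t r k :
  onth cd pc = Some (IJump t r k) -> k <= size cd -> sim c pc s ->
  sim (@step machine c) (if holds t (s r) then pc.+1 else k) s.
Proof.
move=> E kle [c1 pcle reps].
have pclt : pc < size cd by rewrite -onthTE E.
have rR : r <= R by have := regR pc; rewrite (@onth_nth _ (IPop 0) _ _ _ E).
have tE : sees t (read (c.2 (inord r))) = holds t (s r).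
  by rewrite (sees_read _ (reps _)) inordK.
rewrite /step /Defs.next /= c1 /machine_delta /= inordK // E /= ffunE tE.
split=> //=; first by case: ifP.
by move=> i; rewrite !ffunE; case: eqP => [->|_]; apply: rep_stay.
Qed.

(** Induction on the execution rather than on the program, because a [While] executes itself again.
    The code may sit anywhere in [cd], and the counter goes from its first address to the one just
    past it. *)
Lemma exec_sim p s n s' : exec p s n s' ->
  forall c pre post, cd = pre ++ code (size pre) p ++ post -> sim c (size pre) s ->
  sim (iter n (@step machine) c) (size pre + size (code (size pre) p)) s'.
Proof.
have here pre i post : cd = pre ++ i :: post -> onth cd (size pre) = Some i.
  by move->; rewrite onth_cat ltnn subnn.
elim=> {p s n s'} /=.
- by move=> s c pre post _; rewrite addn0.
- by move=> s r b c pre post E S; rewrite addn1; apply: sim_push S; apply: here E.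
- by move=> s r c pre post E S; rewrite addn1; apply: sim_pop S; apply: here E.
- move=> p q s s1 s2 n1 n2 _ IHp _ IHq c pre post E S.
  have S1 := IHp c pre (code (size pre + size (code (size pre) p)) q ++ post).
  rewrite catA in E; have {}S1 := S1 _ S.
  have := IHq (iter n1 (@step machine) c) (pre ++ code (size pre) p) post.
  rewrite [n1 + n2]addnC iterD !size_cat addnA; apply; last by apply: S1; rewrite E !catA.
  by rewrite E !catA.
- move=> t r p q s n s' ht _ IHp c pre post.
  set cp := code _.+1 p; set cq := code _ q => E S.
  have szE : size cd = size pre + size cp + size cq + size post + 2.
    by rewrite E; do 4 rewrite ?size_cat /=; lia.
  have := sim_jump (here _ _ _ E) _ S; rewrite ht => /(_ ltac:(lia)) S1.
  have Ep : cd = rcons pre (IJump t r (size pre + size cp).+2) ++ cp ++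
      (IJump Never 0 ((size pre + size cp).+2 + size cq) :: cq ++ post).
    by rewrite E cat_rcons /= -?catA /= -?catA.
  move: (IHp (@step machine c) (rcons pre (IJump t r (size pre + size cp).+2))).
  rewrite size_rcons -/cp => /(_ _ Ep S1) S2.
  have Eg : cd = (rcons pre (IJump t r (size pre + size cp).+2) ++ cp) ++
      (IJump Never 0 ((size pre + size cp).+2 + size cq) :: cq ++ post).
    by rewrite Ep catA.
  have := here _ _ _ Eg; rewrite size_cat size_rcons => /sim_jump /(_ _ S2) S3.
  rewrite -iterSr in S3; have := S3 ltac:(lia).
  by congr (sim _ _ _); do 4 rewrite ?size_cat /=; lia.
- move=> t r p q s n s' ht _ IHq c pre post.
  set cp := code _.+1 p; set cq := code _ q => E S.
  have szE : size cd = size pre + size cp + size cq + size post + 2.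
    by rewrite E; do 4 rewrite ?size_cat /=; lia.
  have := sim_jump (here _ _ _ E) _ S; rewrite (negbTE ht) => /(_ ltac:(lia)) S1.
  set pre' := pre ++ IJump t r (size pre + size cp).+2 :: cp ++
      [:: IJump Never 0 ((size pre + size cp).+2 + size cq)].
  have Ep : cd = pre' ++ cq ++ post.
    by rewrite /pre' E -?catA /= -?catA /= -?catA.
  have szp : size pre' = (size pre + size cp).+2.
    by rewrite /pre'; do 4 rewrite ?size_cat /=; lia.
  have := IHq (step c) pre' post; rewrite szp -/cq => /(_ Ep S1).
  rewrite -iterSr.
  by congr (sim _ _ _); do 4 rewrite ?size_cat /=; lia.
- move=> t r p s ht c pre post; set cp := code _.+1 p => E S.
  have szE : size cd = size pre + size cp + size post + 2.
    by rewrite E; do 4 rewrite ?size_cat /=; lia.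
  have := sim_jump (here _ _ _ E) _ S; rewrite (negbTE ht) => /(_ ltac:(lia)).
  by congr (sim _ _ _); do 4 rewrite ?size_cat /=; lia.
- move=> t r p s s1 s2 n1 n2 ht _ IHp _ IHw c pre post.
  set cp := code _.+1 p => E S.
  have szE : size cd = size pre + size cp + size post + 2.
    by rewrite E; do 4 rewrite ?size_cat /=; lia.
  have := sim_jump (here _ _ _ E) _ S; rewrite ht => /(_ ltac:(lia)) S1.
  have Ep : cd = rcons pre (IJump t r (size pre + size cp).+2) ++ cp ++
      (IJump Never 0 (size pre) :: post).
    by rewrite E cat_rcons /= -?catA /= -?catA.
  move: (IHp (@step machine c) (rcons pre (IJump t r (size pre + size cp).+2))).
  rewrite size_rcons -/cp => /(_ _ Ep S1) S2.
  have Eg : cd = (rcons pre (IJump t r (size pre + size cp).+2) ++ cp) ++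
      (IJump Never 0 (size pre) :: post).
    by rewrite Ep catA.
  have := here _ _ _ Eg; rewrite size_cat size_rcons => /sim_jump /(_ _ S2) S3.
  rewrite -[X in sim X _ _]/(iter (n1.+2 + n2) (@step machine) c).
  rewrite [n1.+2 + n2]addnC iterD iterS iterSr; apply: (IHw _ _ post); first by [].
  by apply: S3; lia.
Qed.

Lemma sim_init x : sim (init machine x) 0 (upd (fun=> [::]) 0 x).
Proof.
split=> //=; first by congr pair; apply: val_inj; rewrite /= inordK.
move=> i; rewrite ffunE; case: eqP => [->|/eqP ne].
  by rewrite upd_same; split; exists 0; rewrite // /tape_of cats0.
rewrite upd_other //; by split; exists 0.
Qed.

Lemma sim_output c pc s : sim c pc s -> output c = s 0.
Proof.
case=> _ _ /(_ ord0) [_ [k]]; rewrite /output => ->.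
by elim: (s _) => [|b v /= ->] //=; case: k.
Qed.

End Machine.

Definition compute (p : com) (f : seq bool -> seq bool) (T : nat -> nat) :=
  forall x, exists n s, [/\ exec p (upd (fun=> [::]) 0 x) n s, s 0 = f x & n <= T (size x)].

Lemma halted_iter (A : tm) (c : config A) n m :
  Defs.next (iter n (@step A) c) = None -> n <= m -> iter m (@step A) c = iter n (@step A) c.
Proof.
move=> H /subnK <-; elim: (m - n) => [|k IH] //.
by rewrite addSn iterS IH /step H.
Qed.

Lemma exec_polytime p f c k :
  compute p f (fun n => c * n ^ k + c) -> polytime f.
Proof.
move=> H; set cd := code 0 p.
pose R := \max_(i <- cd) reg i.
have regR i : reg (nth (IPop 0) cd i) <= R.
  have [ilt|ile] := ltnP i (size cd); last by rewrite nth_default.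
  by rewrite /R (big_nth (IPop 0)) big_mkord (bigmax_sup (Ordinal ilt)).
exists (machine cd R), c, k => x.
have [n [s [X sE nle]]] := H x.
have cdE : cd = [::] ++ code 0 p ++ [::] by rewrite cats0.
have S := exec_sim regR X cdE (sim_init cd R x); rewrite add0n -/cd in S.
have Hn : Defs.next (iter n (@step _) (init (machine cd R) x)) = None.
  by case: S => c1 _ _; rewrite /Defs.next /= c1 /= /machine_delta /= inordK // onth_default.
rewrite /computes_within (halted_iter Hn nle); split=> //.
by rewrite (sim_output S).
Qed.

(** * Polynomial bounds, binary increment and copying of registers *)

Definition polyb (f : nat -> nat) := exists c k, forall n, f n <= c * n ^ k + c.

Lemma polyb_le f g : (forall n, f n <= g n) -> polyb g -> polyb f.
Proof. by move=> le [c [k H]]; exists c, k => n; apply: leq_trans (le n) (H n). Qed.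

Lemma polyb_cst a : polyb (fun=> a).
Proof. by exists a, 0 => n; rewrite leq_addl. Qed.

Lemma polyb_id : polyb id.
Proof. by exists 1, 1 => n; rewrite mul1n expn1 leq_addr. Qed.

Lemma polyb_add f g : polyb f -> polyb g -> polyb (fun n => f n + g n).
Proof.
move=> [c [k Hf]] [d [l Hg]]; exists ((c + d) * 2), (k + l) => n.
(* The summand 1 is for [n = 0], where [n ^ 0 = 1] exceeds [n ^ b] if [b] is positive. *)
have e a b : n ^ a <= n ^ (a + b) + 1.
  case: n {Hf Hg} => [|n]; first by rewrite (leq_trans _ (leq_addl _ _)) //; case: a => // a; rewrite exp0n.
  by rewrite (leq_trans _ (leq_addr _ _)) // leq_pexp2l // leq_addr.
have := e k l; have := e l k; rewrite [l + k]addnC; have := Hf n; have := Hg n.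
move: (f n) (g n) (n ^ k) (n ^ l) (n ^ (k + l)) => {e Hf Hg}; nia.
Qed.

Lemma polyb_mul f g : polyb f -> polyb g -> polyb (fun n => f n * g n).
Proof.
move=> [c [k Hf]] [d [l Hg]]; exists (c * d * 4), (k + l) => n.
have e a b : n ^ a <= n ^ (a + b) + 1.
  case: n {Hf Hg} => [|n]; first by rewrite (leq_trans _ (leq_addl _ _)) //; case: a => // a; rewrite exp0n.
  by rewrite (leq_trans _ (leq_addr _ _)) // leq_pexp2l // leq_addr.
have := e k l; have := e l k; rewrite [l + k]addnC.
have := leq_mul (Hf n) (Hg n) => H; move=> H1 H2; apply: leq_trans H _.
rewrite mulnDl !mulnDr mulnACA -expnD.
move: (n ^ k) (n ^ l) (n ^ (k + l)) H1 H2 => {e Hf Hg}; nia.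
Qed.

Lemma polyb_exp f k : polyb f -> polyb (fun n => f n ^ k).
Proof.
move=> pf; elim: k => [|k IH]; first exact: polyb_cst.
by apply: polyb_le (polyb_mul pf IH) => n; rewrite expnS.
Qed.

Lemma polyb_comp f g : polyb f -> polyb g -> polyb (fun n => f (g n)).
Proof.
move=> [c [k Hf]] pg; apply: polyb_le (fun n => Hf (g n)) _.
by apply: polyb_add (polyb_cst c); apply: polyb_mul (polyb_cst c) (polyb_exp k pg).
Qed.

Fixpoint binc (s : seq bool) :=
  match s with [::] => [:: true] | true :: s => false :: binc s | false :: s => true :: s end.

Lemma binaryE n : binary n = odd n :: (if n < 2 then [::] else binary n./2).
Proof.
case: ltnP => n2; first by move: n n2 => [|[|]].
rewrite /binary trunc_log2S //; set k := (trunc_log 2 n./2).+1.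
rewrite -[iota 0 k.+1]/(0 :: iota 1 k) map_cons (iotaDl 1 0) -map_comp expn0 divn1.
congr cons; apply: eq_map => i /=.
by rewrite expnS divnMA divn2.
Qed.

Lemma binaryS n : binary n.+1 = binc (binary n).
Proof.
elim/ltn_ind: n => n IH; rewrite (binaryE n.+1) (binaryE n) /=.
have := odd_double_half n; rewrite uphalf_half; case: (odd n) => /=; last first.
  rewrite !add0n => nE; have [n1|n1] := ltnP n 1; first by have -> : n = 0 by lia.
  have -> : (n.+1 < 2) = false by lia.
  by have -> : (n < 2) = false by lia.
rewrite add1n => nE; have [n1|n1] := ltnP n 2; first by have -> : n = 1 by lia.
have -> : (n.+1 < 2) = false by lia.
by rewrite -IH //; lia.
Qed.

Lemma size_binc s : size (binc s) <= (size s).+1.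
Proof. by elim: s => [|[] s IH] //=. Qed.

Definition runs p s m s' := exists n, exec p s n s' /\ n <= m.

Lemma runs_le p s m m' s' : m <= m' -> runs p s m s' -> runs p s m' s'.
Proof. by move=> le [n [X nm]]; exists n; split=> //; apply: leq_trans le. Qed.

Lemma runs_seq p q s s1 s2 m1 m2 :
  runs p s m1 s1 -> runs q s1 m2 s2 -> runs (Seq p q) s (m1 + m2) s2.
Proof.
move=> [n1 [X1 l1]] [n2 [X2 l2]]; exists (n1 + n2).
by split; [apply: XSeq X1 X2 | apply: leq_add].
Qed.

Lemma runs_ite c r p q s s' m :
  runs (if holds c (s r) then p else q) s m s' -> runs (Ite c r p q) s (m + 2) s'.
Proof.
case: ifP => h [n [X l]].
  by exists n.+2; split; [apply: XIteT | rewrite addn2].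
by exists n.+1; split; [apply: XIteF; rewrite ?h | rewrite addn2; apply: ltnW].
Qed.

Lemma runs_push s r b : runs (Push r b) s 2 (upd s r (b :: s r)).
Proof. by exists 2; split=> //; apply: XPush. Qed.

Lemma runs_pop s r : runs (Pop r) s 1 (upd s r (behead (s r))).
Proof. by exists 1; split=> //; apply: XPop. Qed.

Lemma runs_whileF c r p s : ~~ holds c (s r) -> runs (While c r p) s 1 s.
Proof. by move=> h; exists 1; split=> //; apply: XWhileF. Qed.

Lemma runs_whileT c r p s s1 s2 m1 m2 :
  holds c (s r) -> runs p s m1 s1 -> runs (While c r p) s1 m2 s2 ->
  runs (While c r p) s (m1 + 2 + m2) s2.
Proof.
move=> h [n1 [X1 l1]] [n2 [X2 l2]]; exists (n1.+2 + n2).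
by split; [apply: XWhileT X1 X2 | rewrite addn2 leq_add].
Qed.

Ltac store_eq :=
  apply: functional_extensionality => ?; rewrite /upd;
  repeat (case: eqP => //= ?); subst => //=;
  by repeat match goal with H : is_true (?a != ?a) |- _ => by rewrite eqxx in H end.

Lemma upd_upd s r v w : upd (upd s r v) r w = upd s r w.
Proof. store_eq. Qed.

Lemma upd_id s r : upd s r (s r) = s.
Proof. store_eq. Qed.

Lemma upd_id' s r v : s r = v -> upd s r v = s.
Proof. by move<-; apply: upd_id. Qed.

Lemma updC s r v r' v' : r != r' -> upd (upd s r v) r' v' = upd (upd s r' v') r v.
Proof. by move=> ne; store_eq. Qed.

Definition clear r := While NonEmpty r (Pop r).

Lemma runs_clear r s : runs (clear r) s (3 * size (s r) + 1) (upd s r [::]).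
Proof.
move E: (s r) => v; elim: v s E => [|b v IH] s E.
  by rewrite (upd_id' E); apply: runs_whileF; rewrite E.
have := IH (upd s r v) (upd_same _ _ _); rewrite upd_upd => H.
have := runs_pop s r; rewrite E /= => H'.
apply: runs_le (runs_whileT _ H' H); last by rewrite E.
by rewrite /=; lia.
Qed.

(** Register 1 is scratch: copying reverses [w] onto it and then reverses it back into both [w] and
    the target. *)
Definition spill w :=
  While NonEmpty w (Ite TopTrue w (Seq (Pop w) (Push 1 true)) (Seq (Pop w) (Push 1 false))).

(** With [u = true] the target receives only [true], that is, the length of [w] in unary. *)
Definition unspill u w v :=
  While NonEmpty 1 (Ite TopTrue 1
    (Seq (Pop 1) (Seq (Push w true) (Push v true)))
    (Seq (Pop 1) (Seq (Push w false) (Push v u)))).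

Definition copy u w v := Seq (spill w) (unspill u w v).

Lemma runs_spill w s : w != 1 ->
  runs (spill w) s (7 * size (s w) + 1) (upd (upd s w [::]) 1 (catrev (s w) (s 1))).
Proof.
move=> w1; move E: (s w) => v; elim: v s E => [|b v IH] s E.
  by rewrite (upd_id' E) /= upd_id; apply: runs_whileF; rewrite E.
have H : runs (Ite TopTrue w (Seq (Pop w) (Push 1 true)) (Seq (Pop w) (Push 1 false)))
   s 5 (upd (upd s w v) 1 (b :: s 1)).
  apply: (@runs_ite _ _ _ _ _ _ 3); rewrite E /=.
  have H0 := runs_pop s w; rewrite E /= in H0.
  have H1 b' := runs_push (upd s w v) 1 b'.
  rewrite upd_other 1?eq_sym // in H1.
  by case: b E => _; apply: runs_seq H0 (H1 _).
have := IH (upd (upd s w v) 1 (b :: s 1)); rewrite upd_other // !upd_same.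
move=> /(_ erefl) H2.
have -> : upd (upd s w [::]) 1 (catrev (b :: v) (s 1)) =
    upd (upd (upd (upd s w v) 1 (b :: s 1)) w [::]) 1 (catrev v (b :: s 1)).
  by rewrite /=; store_eq.
apply: runs_le (runs_whileT _ H H2); last by rewrite E.
by rewrite /=; lia.
Qed.

Lemma runs_unspill u w v s : w != 1 -> v != 1 -> w != v ->
  runs (unspill u w v) s (9 * size (s 1) + 1)
   (upd (upd (upd s w (catrev (s 1) (s w))) v (catrev [seq b || u | b <- s 1] (s v))) 1 [::]).
Proof.
move=> w1 v1 wv; move E: (s 1) => z; elim: z s E => [|b z IH] s E.
  by rewrite /= !upd_id (upd_id' E); apply: runs_whileF; rewrite E.
pose s1 := upd (upd (upd s 1 z) w (b :: s w)) v ((b || u) :: s v).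
have H : runs (Ite TopTrue 1
    (Seq (Pop 1) (Seq (Push w true) (Push v true)))
    (Seq (Pop 1) (Seq (Push w false) (Push v u)))) s 7 s1.
  apply: (@runs_ite _ _ _ _ _ _ (1 + (2 + 2))); rewrite E /=.
  have H0 := runs_pop s 1; rewrite E /= in H0.
  have H1 b' := runs_push (upd s 1 z) w b'.
  rewrite upd_other // in H1.
  have H2 b' c' : runs (Push v c') (upd (upd s 1 z) w (b' :: s w)) 2
      (upd (upd (upd s 1 z) w (b' :: s w)) v (c' :: s v)).
    have := runs_push (upd (upd s 1 z) w (b' :: s w)) v c'.
    by rewrite [upd _ w _ v]upd_other 1?eq_sym // upd_other.
  by rewrite /s1; case: b {E s1} => /=; apply: runs_seq H0 (runs_seq (H1 _) (H2 _ _)).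
have s11 : s1 1 = z by rewrite /s1 2?upd_other 1?eq_sym // upd_same.
have := IH s1 s11 => H2.
have -> : upd (upd (upd s w (catrev (b :: z) (s w))) v
     (catrev [seq b || u | b <- b :: z] (s v))) 1 [::] =
   upd (upd (upd s1 w (catrev z (s1 w))) v (catrev [seq b || u | b <- z] (s1 v))) 1 [::].
  have -> : s1 w = b :: s w by rewrite /s1 upd_other // upd_same.
  have -> : s1 v = (b || u) :: s v by rewrite /s1 upd_same.
  by rewrite /s1 /=; store_eq.
apply: runs_le (runs_whileT _ H H2); last by rewrite E.
by rewrite /=; lia.
Qed.

Lemma runs_copy u w v s : w != 1 -> v != 1 -> w != v -> s 1 = [::] -> s v = [::] ->
  runs (copy u w v) s (16 * size (s w) + 2) (upd s v [seq b || u | b <- s w]).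
Proof.
move=> w1 v1 wv s1 sv.
set t := upd (upd s w [::]) 1 (rev (s w)).
have H1 : runs (spill w) s (7 * size (s w) + 1) t.
  by have := runs_spill s w1; rewrite s1.
have t1 : t 1 = rev (s w) by rewrite /t upd_same.
have tw : t w = [::] by rewrite /t upd_other // upd_same.
have tv : t v = [::] by rewrite /t !upd_other // eq_sym.
have := runs_unspill u t w1 v1 wv; rewrite t1 tw tv map_rev -!/(rev _) !revK => H2.
have <- : upd (upd (upd t w (s w)) v [seq b || u | b <- s w]) 1 [::] =
    upd s v [seq b || u | b <- s w] by rewrite /t; store_eq.
by apply: runs_le (runs_seq H1 H2); rewrite size_rev; lia.
Qed.

(** * Loop programs *)

(** Every loop is bounded by the length of a register that its body cannot change, and only one
    output register is written. Running time is therefore polynomial by construction. *)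
Inductive cmd :=
  | Skip
  | Emit of bool
  | Inc
  | Cat of cmd & cmd
  | For of nat & nat & cmd
  | Bit of nat & nat & nat & cmd & cmd.

(* The output register is a stack, so what is emitted last comes first:
   [Cat] and [For] run backwards. *)
Fixpoint sem p (s : store) (o : seq bool) : seq bool :=
  match p with
  | Skip => o
  | Emit b => b :: o
  | Inc => binc o
  | Cat p q => sem p s (sem q s o)
  | For v w p => foldr (fun i => sem p (upd s v (nseq i true))) o (iota 0 (size (s w)))
  | Bit k r v p q =>
      if nth false (s r) (size (s v) + k) then sem p s o else sem q s o
  end.

(** [U] lists the registers that may be read: the inputs and the loop variables in scope. Loop
    variables avoid the scratch registers 1, 2 and 3. *)
Fixpoint wf o U p :=
  match p with
  | Skip | Emit _ | Inc => true
  | Cat p q => wf o U p && wf o U q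
  | For v w p => [&& v > 3, v != o, v \notin U, w \in U & wf o (v :: U) p]
  | Bit _ r v p q => [&& r \in U, v \in U, wf o U p & wf o U q]
  end.

(** The leading ones are moved to register 1, the zero below them (if any) becomes a one, and a zero
    is put back for each one moved. *)
Definition incr o :=
  Seq (While TopTrue o (Seq (Pop o) (Push 1 true)))
  (Seq (Pop o) (Seq (Push o true)
    (While NonEmpty 1 (Seq (Pop 1) (Push o false))))).

Fixpoint pushn k r := if k is k.+1 then Seq (Push r true) (pushn k r) else Nop.

(** Loop counters are unary and run downwards, which is the evaluation order of [foldr] in [sem].
    [Bit] puts a copy of [r] in 2 and the index in 3, then pops both until 3 is empty: the wanted
    bit is on top of 2, or 2 is empty, which agrees with the default [false]. *)
Fixpoint compile o p : com :=
  match p with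
  | Skip => Nop
  | Emit b => Push o b
  | Inc => incr o
  | Cat p q => Seq (compile o q) (compile o p)
  | For v w p => Seq (copy true w v) (While NonEmpty v (Seq (Pop v) (compile o p)))
  | Bit k r v p q =>
      Seq (copy false r 2) (Seq (copy true v 3) (Seq (pushn k 3)
      (Seq (While NonEmpty 3 (Seq (Pop 3) (Pop 2)))
      (Ite TopTrue 2 (Seq (clear 2) (compile o p)) (Seq (clear 2) (compile o q))))))
  end.

Fixpoint grow p m :=
  match p with
  | Skip => 0
  | Emit _ | Inc => 1
  | Cat p q => grow p m + grow q m
  | For _ _ p => m * grow p m
  | Bit _ _ _ p q => grow p m + grow q m
  end.

(** Here [m] bounds the output register too. Hence the larger argument for code that runs after
    other output, be it that of [q] or that of earlier rounds of a loop. *)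
Fixpoint cost p m :=
  match p with
  | Skip => 0
  | Emit _ => 2
  | Inc => 10 * m + 10
  | Cat p q => cost q m + cost p (m + grow q m)
  | For _ _ p => 16 * m + 3 + m * (3 + cost p (m + m * grow p m))
  | Bit k _ _ p q => 100 * m + 10 * k + 20 + (cost p m + cost q m)
  end.

Lemma polyb_grow p : polyb (grow p).
Proof.
elim: p => /= [|_||p IHp q IHq|_ _ p IHp|_ _ _ p IHp q IHq];
  try exact: polyb_cst; try exact: polyb_add.
by apply: polyb_mul => //; apply: polyb_id.
Qed.

Lemma polyb_cost p : polyb (cost p).
Proof.
have G := polyb_grow.
elim: p => /= [|_||p IHp q IHq|_ _ p IHp|k _ _ p IHp q IHq];
  try exact: polyb_cst.
- by apply: polyb_add; [apply: polyb_mul; [apply: polyb_cst|apply: polyb_id]|apply: polyb_cst].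
- apply: polyb_add => //; apply: (polyb_comp IHp).
  by apply: polyb_add => //; apply: polyb_id.
- apply: polyb_add.
    by apply: polyb_add; [apply: polyb_mul; [apply: polyb_cst|apply: polyb_id]|apply: polyb_cst].
  apply: polyb_mul; first exact: polyb_id.
  apply: polyb_add; first exact: polyb_cst.
  apply: (polyb_comp IHp); apply: polyb_add; first exact: polyb_id.
  by apply: polyb_mul => //; apply: polyb_id.
- apply: polyb_add; last exact: polyb_add.
  apply: polyb_add; last exact: polyb_cst.
  apply: polyb_add; last exact: polyb_cst.
  by apply: polyb_mul; [apply: polyb_cst|apply: polyb_id].
Qed.

Lemma sem_eq o U p s s' : wf o U p -> (forall r, r \in U -> s r = s' r) ->
  sem p s =1 sem p s'.
Proof.
elim: p U s s' => //= [p IHp q IHq|v w p IH|k r v p IHp q IHq] U s s'.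
- by move=> /andP[wp wq] E x; rewrite (IHq _ _ _ wq E) (IHp _ _ _ wp E).
- move=> /and5P[_ _ vU wU wp] E x; rewrite (E _ wU).
  elim: (iota _ _) => //= i l ->; apply: (IH (v :: U)) => // r.
  by rewrite inE /upd; case: eqP => //= _ /E.
- move=> /and4P[rU vU wp wq] E x; rewrite !E //.
  by rewrite (IHp _ _ _ wp E) (IHq _ _ _ wq E).
Qed.

Lemma size_sem o U p s m x : wf o U p -> (forall r, r \in U -> size (s r) <= m) ->
  size (sem p s x) <= size x + grow p m.
Proof.
elim: p U s x => /= [|b||p IHp q IHq|v w p IH|k r v p IHp q IHq] U s x.
- by rewrite addn0.
- by rewrite addn1.
- by rewrite addn1 size_binc.
- move=> /andP[wp wq] H; have := IHp _ _ (sem q s x) wp H; have := IHq _ _ x wq H; lia.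
- move=> /and5P[_ _ vU wU wp] H.
  have inner (l : seq nat) : (forall i, i \in l -> i <= m) ->
      size (foldr (fun i => sem p (upd s v (nseq i true))) x l) <= size x + size l * grow p m.
    elim: l => [|i l IHl] li /=; first by rewrite leq_addr.
    move: (foldr _ _ _) IHl => y IHl.
    apply: (leq_trans (n := size y + grow p m)); last first.
      have : forall j, j \in l -> j <= m by move=> j jl; apply: li; rewrite inE jl orbT.
      by move=> /IHl; rewrite mulSn; lia.
    apply: IH wp _ => r; rewrite inE /upd; case: eqP => /= _; last exact: H.
    by rewrite size_nseq li // mem_head.
  apply: leq_trans (inner _ _) _.
    by move=> i; rewrite mem_iota; have := H _ wU; lia.
  by rewrite size_iota leq_add2l leq_mul2r H ?orbT.
- move=> /and4P[_ _ wp wq] H; case: ifP => _.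
    by have := IHp _ _ x wp H; lia.
  by have := IHq _ _ x wq H; lia.
Qed.

(** Registers that are not live are empty, as [copy] requires of its target and of its scratch. *)
Definition ctx o U (s : store) :=
  [/\ o \notin U, (forall r, r \in o :: U -> r \notin [:: 1; 2; 3])
    & forall r, r \notin o :: U -> s r = [::]].

Lemma bincE s :
  binc s = nseq (find negb s) false ++ true :: behead (drop (find negb s) s).
Proof. by elim: s => [|[] s IH] //=; rewrite IH. Qed.

Lemma nseq_cons T j (x : T) l : nseq j x ++ x :: l = x :: nseq j x ++ l.
Proof. by elim: j => //= j ->. Qed.

Lemma runs_incr o s : o != 1 -> s 1 = [::] ->
  runs (incr o) s (10 * size (s o) + 10) (upd s o (binc (s o))).
Proof.
move=> o1.
have R1 : forall z t, t o = z -> runs (While TopTrue o (Seq (Pop o) (Push 1 true)))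
    t (5 * size z + 1)
    (upd (upd t o (drop (find negb z) z)) 1 (nseq (find negb z) true ++ t 1)).
  elim=> [|[] z IH] t E.
  - by rewrite /= (upd_id' E) upd_id; apply: runs_whileF; rewrite E.
  - have H0 := runs_pop t o; rewrite E /= in H0.
    have H1 := runs_push (upd t o z) 1 true; rewrite upd_other 1?eq_sym // in H1.
    have := IH (upd (upd t o z) 1 (true :: t 1)); rewrite upd_other // !upd_same.
    rewrite nseq_cons => /(_ erefl) H2.
    have -> : upd (upd t o (drop (find negb (true :: z)) (true :: z))) 1
       (nseq (find negb (true :: z)) true ++ t 1) =
       upd (upd (upd (upd t o z) 1 (true :: t 1)) o (drop (find negb z) z)) 1
         (true :: nseq (find negb z) true ++ t 1) by store_eq.
    apply: runs_le (runs_whileT _ (runs_seq H0 H1) H2); last by rewrite E.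
    by rewrite /=; lia.
  - rewrite /= (upd_id' E) upd_id; apply: runs_le (_ : 1 <= _) (runs_whileF _ _).
      by lia.
    by rewrite E.
have R2 : forall j t, t 1 = nseq j true ->
    runs (While NonEmpty 1 (Seq (Pop 1) (Push o false))) t (5 * j + 1)
    (upd (upd t o (nseq j false ++ t o)) 1 [::]).
  elim=> [|j IH] t E.
    by rewrite /= upd_id (upd_id' E); apply: runs_whileF; rewrite E.
  have H0 := runs_pop t 1; rewrite E /= in H0.
  have H1 := runs_push (upd t 1 (nseq j true)) o false; rewrite upd_other // in H1.
  have := IH (upd (upd t 1 (nseq j true)) o (false :: t o)).
  rewrite upd_other 1?eq_sym // !upd_same nseq_cons => /(_ erefl) H2.
  have -> : upd (upd t o (nseq j.+1 false ++ t o)) 1 [::] =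
      upd (upd (upd (upd t 1 (nseq j true)) o (false :: t o)) o
        (false :: nseq j false ++ t o)) 1 [::] by store_eq.
  apply: runs_le (runs_whileT _ (runs_seq H0 H1) H2); last by rewrite E.
  by rewrite /=; lia.
move=> s1; have H1 := R1 _ s erefl; rewrite s1 cats0 in H1.
set z := s o in H1 *; set k := find negb z in H1 *; set t1 := upd _ 1 (nseq k true) in H1.
have t1o : t1 o = drop k z by rewrite /t1 upd_other // upd_same.
have H2 := runs_pop t1 o; rewrite t1o in H2.
have H3 := runs_push (upd t1 o (behead (drop k z))) o true.
rewrite upd_same upd_upd in H3.
have H4 := R2 k (upd t1 o (true :: behead (drop k z))).
rewrite upd_other 1?eq_sym // upd_same upd_upd in H4.
have <- : upd (upd t1 o (nseq k false ++ true :: behead (drop k z))) 1 [::] =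
    upd s o (binc z) by rewrite bincE /t1 -/k; store_eq.
apply: runs_le (runs_seq H1 (runs_seq H2 (runs_seq H3 (H4 _)))); last first.
  by rewrite /t1 upd_same.
have : k <= size z by apply: find_size.
lia.
Qed.

Lemma runs_pushn k r s j : s r = nseq j true ->
  runs (pushn k r) s (2 * k) (upd s r (nseq (j + k) true)).
Proof.
elim: k j s => [|k IH] j s E; first by exists 0; rewrite addn0 upd_id' //; split => //; apply: XNop.
have H := runs_push s r true; have := IH j.+1 (upd s r (true :: s r)).
rewrite upd_same E => /(_ erefl) H'; rewrite addnS -addSn -(upd_upd _ _ (true :: s r)) E.
by rewrite -E in H' *; apply: runs_le (runs_seq H H'); lia.
Qed.

Lemma runs_index s :
  runs (While NonEmpty 3 (Seq (Pop 3) (Pop 2))) s (4 * size (s 3) + 1)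
    (upd (upd s 2 (drop (size (s 3)) (s 2))) 3 [::]).
Proof.
move E: (s 3) => z; elim: z s E => [|b z IH] s E.
  by rewrite drop0 upd_id (upd_id' E); apply: runs_whileF; rewrite E.
have H0 := runs_pop s 3; rewrite E /= in H0.
have H1 := runs_pop (upd s 3 z) 2; rewrite upd_other // in H1.
have := IH (upd (upd s 3 z) 2 (behead (s 2))).
rewrite upd_other // !upd_same => /(_ erefl) H2.
have <- : upd (upd (upd (upd s 3 z) 2 (behead (s 2))) 2 (drop (size z) (behead (s 2)))) 3 [::]
   = upd (upd s 2 (drop (size (b :: z)) (s 2))) 3 [::].
  by rewrite -drop1 drop_drop addn1; store_eq.
apply: runs_le (runs_whileT _ (runs_seq H0 H1) H2); last by rewrite E.
by rewrite /=; lia.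
Qed.

(** The body need only be correct on outputs of a size that can occur: before the round with index
    [i], there have been [n - i.+1] rounds, each adding at most [m] bits. *)
Lemma runs_loop o v f C s m (n : nat) body :
  v != o -> v != 1 -> s v = [::] ->
  (forall i x, i < n -> size x <= size (s o) + (n - i.+1) * m ->
    runs body (upd (upd s o x) v (nseq i true)) C
      (upd (upd s o (f i x)) v (nseq i true)) /\ size (f i x) <= size x + m) ->
  runs (While NonEmpty v (Seq (Pop v) body)) (upd s v (nseq n true))
    (n * (3 + C) + 1) (upd s o (foldr f (s o) (iota 0 n))).
Proof.
move=> vo v1 sv H.
have G : forall j x, j <= n -> size x <= size (s o) + (n - j) * m ->
    runs (While NonEmpty v (Seq (Pop v) body)) (upd (upd s o x) v (nseq j true))
      (j * (3 + C) + 1) (upd s o (foldr f x (iota 0 j))).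
  elim=> [|j IH] x jn sx.
    rewrite /= (_ : upd (upd s o x) v [::] = upd s o x); last first.
      by rewrite upd_id' // upd_other.
    by apply: runs_whileF; rewrite upd_other ?sv.
  have [B sB] := H j x jn sx.
  have P := runs_pop (upd (upd s o x) v (nseq j.+1 true)) v.
  rewrite upd_same upd_upd /= in P.
  have := IH (f j x) (ltnW jn) _; rewrite -subnSK // mulSn => /(_ _) W.
  rewrite -[in iota 0 _]addn1 iotaD foldr_cat /= add0n.
  have {}W := W ltac:(lia).
  apply: runs_le (runs_whileT _ (runs_seq P B) W); last by rewrite upd_same.
  by rewrite mulSn; lia.
by have := G n (s o) (leqnn _); rewrite upd_id; apply; rewrite subnn addn0.
Qed.

Lemma compile_runs o p : forall U s m, wf o U p -> ctx o U s ->
  (forall r, r \in o :: U -> size (s r) <= m) ->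
  runs (compile o p) s (cost p m) (upd s o (sem p s (s o))).
Proof.
elim: p => /= [|b||p IHp q IHq|v w p IH|k r v p IHp q IHq] U s m.
- by move=> _ _ _; exists 0; rewrite upd_id; split=> //; apply: XNop.
- by move=> _ _ _; apply: runs_push.
- move=> _ [_ T clean] B; have o1 : o != 1.
    by have := T o (mem_head _ _); rewrite !inE !negb_or => /andP[].
  have s1 : s 1 = [::].
    by apply: clean; apply: contraL (T 1) _; rewrite ?inE // => /T.
  apply: runs_le (runs_incr o1 s1).
  by have := B o (mem_head _ _); lia.
- move=> /andP[wp wq] X B.
  have [oU T clean] := X.
  have R1 := IHq _ _ _ wq X B.
  set s1 := upd s o _ in R1.
  have s1U : forall r, r \in U -> s1 r = s r.
    by move=> r rU; rewrite /s1 upd_other //; apply: contraNneq oU => <-.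
  have X1 : ctx o U s1.
    split=> // r rU; rewrite /s1 upd_other ?clean //.
    by apply: contraNneq rU => ->; rewrite mem_head.
  have B1 : forall r, r \in o :: U -> size (s1 r) <= m + grow q m.
    move=> r; rewrite inE => /orP[/eqP->|rU].
      rewrite /s1 upd_same (leq_trans (size_sem _ wq (m := m) _)) //.
        by move=> r' r'U; apply: B; rewrite inE r'U orbT.
      by rewrite leq_add2r B // mem_head.
    by rewrite s1U // (leq_trans (B _ _)) ?leq_addr // inE rU orbT.
  have R2 := IHp _ _ _ wp X1 B1.
  rewrite (_ : upd s o _ = upd s1 o (sem p s1 (s1 o))); first exact: runs_seq R1 R2.
  by rewrite {1 3}/s1 upd_same upd_upd (sem_eq wp s1U).
- move=> /and5P[v3 vo vU wU wp] X B.
  have [oU T clean] := X.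
  have nt r : r \in U -> r != 1.
    by move=> rU; have := T r; rewrite !inE rU orbT !negb_or => /(_ isT) /andP[].
  have s1 : s 1 = [::].
    by apply: clean; apply/negP => /T.
  have sv : s v = [::] by apply: clean; rewrite inE negb_or vo.
  have v1 : v != 1 by case: v v3 {vo vU wp sv} => [|[|]].
  have wv : w != v by apply: contraNneq vU => <-.
  have sw : size (s w) <= m by apply: B; rewrite inE wU orbT.
  have so : size (s o) <= m by apply: B; rewrite mem_head.
  have R1 := runs_copy true (nt _ wU) v1 wv s1 sv.
  rewrite (_ : map _ _ = nseq (size (s w)) true) in R1; last first.
    by elim: (s w) => //= b l ->; rewrite orbT.
  have R2 : runs (While NonEmpty v (Seq (Pop v) (compile o p)))
      (upd s v (nseq (size (s w)) true))
      (size (s w) * (3 + cost p (m + m * grow p m)) + 1)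
      (upd s o (foldr (fun i => sem p (upd s v (nseq i true))) (s o) (iota 0 (size (s w))))).
    apply: (runs_loop (m := grow p m)) => // i x il sx.
    have X1 : ctx o (v :: U) (upd (upd s o x) v (nseq i true)).
      split.
      - by rewrite inE negb_or eq_sym vo.
      - move=> r; rewrite inE orbCA -!in_cons => /predU1P[->|/T //].
        by rewrite !inE; case: v v3 {vo vU wp sv R1 v1 wv} => [|[|[|[|]]]].
      - move=> r; rewrite !inE !negb_or => /and3P[ro rv rU].
        by rewrite !upd_other // clean // inE negb_or ro.
    have xm : size x <= m + m * grow p m.
      apply: leq_trans sx _; apply: leq_add => //; rewrite leq_mul2r.
      by apply/orP; right; lia.
    have B1 : forall r, r \in o :: v :: U ->
        size (upd (upd s o x) v (nseq i true) r) <= m + m * grow p m.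
      move=> r rU; rewrite /upd; case: eqP => [_|/eqP rv].
        by rewrite size_nseq; lia.
      case: eqP => // _; apply: leq_trans (B r _) (leq_addr _ _).
      by move: rU; rewrite !inE (negbTE rv).
    (* The body does not read the output register, so what earlier rounds wrote does not influence
       it. *)
    have E : sem p (upd (upd s o x) v (nseq i true)) =1 sem p (upd s v (nseq i true)).
      apply: sem_eq wp _ => r; rewrite inE /upd; case: eqP => //= _ rU.
      by case: eqP => // ro; rewrite -ro rU in oU.
    split.
      have := IH _ _ _ wp X1 B1.
      rewrite [upd _ v _ o]upd_other 1?eq_sym // upd_same E.
      by rewrite (updC _ _ _ vo) upd_upd.
    apply: size_sem wp _ => r; rewrite inE /upd; case: eqP => [_ _|_ /= rU].
      by rewrite size_nseq; lia.
    by apply: B; rewrite inE rU orbT.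
  apply: runs_le (runs_seq R1 R2).
  have : size (s w) * (3 + cost p (m + m * grow p m)) <= m * (3 + cost p (m + m * grow p m)).
    by rewrite leq_mul2r sw orbT.
  lia.
- move=> /and4P[rU vU wp wq] X B.
  have [oU T clean] := X.
  have notT r' : r' \in [:: 1; 2; 3] -> r' \notin o :: U.
    by apply: contraL => /T.
  have [s1 s2 s3] : [/\ s 1 = [::], s 2 = [::] & s 3 = [::]].
    by split; apply: clean; apply: notT.
  have nt r' i : r' \in U -> i \in [:: 1; 2; 3] -> r' != i.
    move=> r'U iT; apply: contraL iT => /eqP <-; apply: T.
    by rewrite inE r'U orbT.
  have R1 := runs_copy false (nt _ 1 rU isT) (isT : 2 != 1) (nt _ 2 rU isT) s1 s2.
  rewrite (eq_map (fun b => orbF b)) map_id in R1.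
  have R2 := runs_copy true (s := upd s 2 (s r)) (nt _ 1 vU isT) (isT : 3 != 1) (nt _ 3 vU isT).
  rewrite !upd_other // ?nt // in R2; have {}R2 := R2 s1 s3.
  rewrite (_ : map _ _ = nseq (size (s v)) true) in R2; last first.
    by elim: (s v) => //= b l ->; rewrite orbT.
  have R3 := runs_pushn k (upd_same (upd s 2 (s r)) 3 (nseq (size (s v)) true)).
  rewrite upd_upd in R3.
  have R4 := runs_index (upd (upd s 2 (s r)) 3 (nseq (size (s v) + k) true)).
  rewrite upd_same [upd _ 3 _ 2]upd_other // upd_same size_nseq in R4.
  set d := drop _ _ in R4.
  have E4 : upd (upd (upd (upd s 2 (s r)) 3 (nseq (size (s v) + k) true)) 2 d) 3 [::] = upd s 2 d.
    by store_eq.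
  rewrite E4 in R4.
  have R5 := runs_clear 2 (upd s 2 d).
  rewrite upd_same upd_upd (upd_id' s2) in R5.
  have bound r' : r' \in U -> size (s r') <= m by move=> h; apply: B; rewrite inE h orbT.
  have dle : size d <= m by rewrite size_drop (leq_trans (leq_subr _ _)) ?bound.
  have hd : holds TopTrue d = nth false (s r) (size (s v) + k).
    by rewrite /= -nth0 nth_drop addn0.
  have R6 : runs (Ite TopTrue 2 (Seq (clear 2) (compile o p)) (Seq (clear 2) (compile o q)))
      (upd s 2 d) (3 * size d + 1 + (cost p m + cost q m) + 2)
      (upd s o (if nth false (s r) (size (s v) + k) then sem p s (s o) else sem q s (s o))).
    apply: runs_ite; rewrite upd_same hd; case: ifP => _.
      by apply: runs_seq R5 _; apply: runs_le (IHp _ _ _ wp X B); lia.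
    by apply: runs_seq R5 _; apply: runs_le (IHq _ _ _ wq X B); lia.
  apply: runs_le (runs_seq R1 (runs_seq R2 (runs_seq R3 (runs_seq R4 R6)))).
  by have := bound _ rU; have := bound _ vU; lia.
Qed.

(** * Polynomial-time pipelines *)

Definition start x : store := upd (fun=> [::]) 0 x.

(** A form of polynomial time that composes: the size bound [S] makes the cost of the next program
    polynomial in the original input. *)
Definition reach (st : seq bool -> store) := exists p T S,
  [/\ polyb T, polyb S, (forall x r, size (st x r) <= S (size x))
    & forall x, runs p (start x) (T (size x)) (st x)].

Lemma reach_start : reach start.
Proof.
exists Nop, (fun=> 0), id; split; first exact: polyb_cst.
- exact: polyb_id.
- by move=> x r; rewrite /start /upd; case: eqP.
- by move=> x; exists 0; split=> //; apply: XNop.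
Qed.

Lemma reach_compile st o U q f : reach st -> wf o U q -> (forall x, ctx o U (st x)) ->
  (forall x, sem q (st x) (st x o) = f x) ->
  reach (fun x => upd (st x) o (f x)).
Proof.
move=> [p [T [S [pT pS sz H]]]] w X F.
exists (Seq p (compile o q)), (fun n => T n + cost q (S n)), (fun n => S n + grow q (S n)); split.
- by apply: polyb_add => //; apply: polyb_comp => //; apply: polyb_cost.
- by apply: polyb_add => //; apply: polyb_comp => //; apply: polyb_grow.
- move=> x r; rewrite -F /upd; case: eqP => _; last by rewrite (leq_trans (sz _ _)) ?leq_addr.
  rewrite (leq_trans (size_sem _ w (m := S (size x)) _)) //.
  by rewrite leq_add2r.
- by move=> x; rewrite -F; apply: runs_seq (H x) (compile_runs w (X x) _).
Qed.

Lemma reach_clear st r : reach st ->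
  reach (fun x => upd (st x) r [::]).
Proof.
move=> [p [T [S [pT pS sz H]]]].
exists (Seq p (clear r)), (fun n => T n + (3 * S n + 1)), S; split=> //.
- apply: polyb_add => //; apply: polyb_add; last exact: polyb_cst.
  by apply: polyb_mul => //; apply: polyb_cst.
- by move=> x r'; rewrite /upd; case: eqP.
- move=> x; apply: runs_seq (H x) _; apply: runs_le (runs_clear _ _).
  by rewrite leq_add2r leq_mul2l sz.
Qed.

Lemma reach_polytime st : reach st -> polytime (fun x => st x 0).
Proof.
move=> [p [T [S [[c [k pT]] _ _ H]]]]; apply: (exec_polytime (p := p) (c := c) (k := k)) => x.
have [n [X le]] := H x; exists n, (st x); split=> //.
exact: leq_trans le (pT _).
Qed.

(** * Programs that prepend a fixed string to the output *)

Definition emits p s z := forall o, sem p s o = z ++ o.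

Lemma emits_cat p q s y z : emits p s y -> emits q s z -> emits (Cat p q) s (y ++ z).
Proof. by move=> Hp Hq o; rewrite /= Hq Hp catA. Qed.

Lemma emits_for v w p s g :
  (forall i, i < size (s w) -> emits p (upd s v (nseq i true)) (g i)) ->
  emits (For v w p) s (flatten [seq g i | i <- iota 0 (size (s w))]).
Proof.
move=> H o /=; have : forall i, i \in iota 0 (size (s w)) -> i < size (s w).
  by move=> i; rewrite mem_iota.
elim: (iota _ _) => //= i l IH li.
rewrite H ?li ?mem_head // IH ?catA // => j jl.
by apply: li; rewrite inE jl orbT.
Qed.

Lemma emits_bit k r v p q s y z : emits p s y -> emits q s z ->
  emits (Bit k r v p q) s (if nth false (s r) (size (s v) + k) then y else z).
Proof. by move=> Hp Hq o /=; case: ifP. Qed.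

Definition cats := foldr Cat Skip.

Lemma emits_cats (T : Type) (f : T -> cmd) g l s : (forall x, emits (f x) s (g x)) ->
  emits (cats (map f l)) s (flatten (map g l)).
Proof. by move=> H o; elim: l => //= x l ->; rewrite H catA. Qed.

Lemma wf_cats (T : Type) o U (f : T -> cmd) l : (forall x, wf o U (f x)) ->
  wf o U (cats (map f l)).
Proof. by move=> H; elim: l => //= x l ->; rewrite H. Qed.

Definition emit z := cats (map Emit z).

Lemma emits_emit z s : emits (emit z) s z.
Proof. by move=> o; rewrite /emit; elim: z => //= b z ->. Qed.

Lemma wf_emit o U z : wf o U (emit z).
Proof. exact: wf_cats. Qed.

Fixpoint power k w v := if k is k.+1 then For v w (power k w v.+1) else Emit true.

Lemma flatten_const (T I : Type) (l : seq I) (z : seq T) :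
  flatten [seq z | _ <- l] = flatten (nseq (size l) z).
Proof. by elim: l => //= _ l ->. Qed.

Lemma flatten_nseq (T : Type) (a : T) m n : flatten (nseq m (nseq n a)) = nseq (m * n) a.
Proof. by elim: m => //= m ->; rewrite mulSn nseqD. Qed.

Lemma emits_power k w v s : w < v -> emits (power k w v) s (nseq (size (s w) ^ k) true).
Proof.
elim: k v s => [|k IH] v s wv; first by move=> o.
have := @emits_for v w (power k w v.+1) s (fun=> nseq (size (s w) ^ k) true).
rewrite flatten_const size_iota flatten_nseq -expnS; apply=> i _.
have := IH v.+1 (upd s v (nseq i true)) (ltnW wv); rewrite upd_other //.
by rewrite neq_ltn wv.
Qed.

Lemma wf_power o U k w v : w \in U -> 3 < v -> o < v -> (forall u, u \in U -> u < v) ->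
  wf o U (power k w v).
Proof.
elim: k v U => //= k IH v U wU v3 ov Uv.
rewrite v3 neq_ltn ov orbT wU /= IH ?andbT //.
- by apply/negP => /Uv; rewrite ltnn.
- by rewrite inE wU orbT.
- by rewrite ltnW.
- by rewrite ltnW.
- by move=> u; rewrite inE => /predU1P[->|/Uv /ltnW].
Qed.

Definition poly c k w := cats (nseq c (power k w 10)).

Lemma emits_poly c k w s : w < 10 -> emits (poly c k w) s (nseq (c * size (s w) ^ k) true).
Proof.
move=> w10; have := @emits_cats _ (fun=> power k w 10) _ (nseq c tt) s
  (fun=> emits_power k s w10).
by rewrite map_nseq flatten_const size_nseq flatten_nseq.
Qed.

Lemma wf_poly o U c k w : w \in U -> o < 10 -> all (fun u => u < 10) U ->
  wf o U (poly c k w).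
Proof.
move=> wU o10 /allP U10; have := @wf_cats _ o U (fun=> power k w 10) (nseq c tt).
by rewrite map_nseq; apply=> _; apply: wf_power.
Qed.

Lemma sem_incs m s n : sem (cats (nseq m Inc)) s (binary n) = binary (m + n).
Proof. by elim: m => //= m ->; rewrite addSn binaryS. Qed.

(** Nested loops around [Inc] compute a product directly in binary, which is how the budget is
    obtained. *)
Lemma sem_count v w p s c : v != w ->
  (forall s' n, s' w = s w -> sem p s' (binary n) = binary (c + n)) ->
  forall n, sem (For v w p) s (binary n) = binary (size (s w) * c + n).
Proof.
move=> vw H n /=; rewrite -[in RHS](size_iota 0 (size (s w))).
elim: (iota _ _) => //= i l ->; rewrite H ?mulSn ?addnA //.
by rewrite upd_other // eq_sym.
Qed.

Section Registers.

Variables (c k c' k' kap : nat).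

(** Bound on the verifier's input [enc_str x ++ u]: the first part has length 2n + 1, the
    certificate at most the rest. *)
Definition bound_of n := n.*2.+1 + (c * n ^ k + c).
(** Side of the tableau: there is room for the longest verifier input, and the row above the last
    one comes after the verifier has halted. *)
Definition side_of n := bound_of n + (c' * bound_of n ^ k' + c') + 3.

(* Register 0, first the input and finally the output, is cleared in between;
   9 stays empty to serve as the number zero. *)
Definition registers x : store := fun r =>
  match r with
  | 4 => enc_str x
  | 5 => nseq (size x).*2.+1 true
  | 6 => nseq (bound_of (size x)) true
  | 7 => nseq (side_of (size x)) true
  | 8 => binary (side_of (size x) * (side_of (size x) * kap))
  | _ => [::]
  end.

Lemma enc_strE x : enc_str x = flatten [seq [:: true; b] | b <- x] ++ [:: false].
Proof. by []. Qed.

Lemma size_enc_str x : size (enc_str x) = (size x).*2.+1.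
Proof. by rewrite enc_strE size_cat addn1; elim: x => //= b x [->]. Qed.

Ltac ctx_tac :=
  split=> //; first exact/allP;
  by move=> r; rewrite /start /upd; repeat (case: eqP => [-> //|_]).

Lemma polytime_cmd p : wf 0 [:: 4; 5; 6; 7; 8; 9] p ->
  polytime (fun x => sem p (registers x) [::]).
Proof.
move=> wp; have R0 := reach_start.
have R1 : reach (fun x => upd (start x) 4 (enc_str x)).
  apply: (@reach_compile _ 4 [:: 0]
    (Cat (For 10 0 (Cat (Emit true) (Bit 0 0 10 (Emit true) (Emit false)))) (Emit false))
    _ R0) => // x; first by ctx_tac.
  rewrite enc_strE [start x 4]/= -[RHS]cats0.
  apply: emits_cat; last by [].
  have -> : flatten [seq [:: true; b] | b <- x] =
      flatten [seq [:: true; nth false x i] | i <- iota 0 (size (start x 0))].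
    rewrite -{1}(mkseq_nth false x) /mkseq -map_comp.
    by congr flatten; apply: eq_map.
  apply: emits_for => i ilt; apply: (@emits_cat _ _ _ [:: true] [:: _]) => // o /=.
  by rewrite upd_same upd_other // size_nseq addn0 /start upd_same; case: nth.
have R2 : reach (fun x => upd (upd (start x) 4 (enc_str x)) 5 (nseq (size x).*2.+1 true)).
  apply: (@reach_compile _ 5 [:: 0; 4] (poly 1 1 4) _ R1) => [|x|x].
  - exact: wf_poly.
  - by ctx_tac.
  by rewrite emits_poly // upd_same size_enc_str mul1n expn1 /= cats0.
(* A power with exponent 0 emits a single mark, so [poly c 0 0] produces the constant [c]. *)
have R3 : reach (fun x => upd (upd (upd (start x) 4 (enc_str x)) 5
    (nseq (size x).*2.+1 true)) 6 (nseq (bound_of (size x)) true)).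
  apply: (@reach_compile _ 6 [:: 0; 4; 5]
    (Cat (poly 1 1 5) (Cat (poly c k 0) (poly c 0 0))) _ R2) => [|x|x].
  - by rewrite /= !wf_poly.
  - by ctx_tac.
  rewrite (emits_cat (emits_poly _ _ _ _) (emits_cat (emits_poly _ _ _ _)
    (emits_poly _ _ _ _))) // cats0 -!nseqD.
  by congr (nseq _ _); rewrite mul1n expn1 expn0 muln1 upd_same size_nseq /start /upd /= /bound_of; lia.
have R4 : reach (fun x => upd (upd (upd (upd (start x) 4 (enc_str x)) 5
    (nseq (size x).*2.+1 true)) 6 (nseq (bound_of (size x)) true)) 7
    (nseq (side_of (size x)) true)).
  apply: (@reach_compile _ 7 [:: 0; 4; 5; 6]
    (Cat (poly 1 1 6) (Cat (poly c' k' 6) (poly (c' + 3) 0 6))) _ R3) => [|x|x].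
  - by rewrite /= !wf_poly.
  - by ctx_tac.
  rewrite (emits_cat (emits_poly _ _ _ _) (emits_cat (emits_poly _ _ _ _)
    (emits_poly _ _ _ _))) // cats0 -!nseqD.
  by congr (nseq _ _); rewrite mul1n expn1 expn0 muln1 upd_same size_nseq /side_of; lia.
have R5 := @reach_compile _ 8 [:: 0; 4; 5; 6; 7]
  (Cat (For 10 7 (For 11 7 (cats (nseq kap Inc)))) (Emit false))
  (fun x => binary (side_of (size x) * (side_of (size x) * kap))) R4.
have w5 : wf 8 [:: 0; 4; 5; 6; 7]
    (Cat (For 10 7 (For 11 7 (cats (nseq kap Inc)))) (Emit false)).
  rewrite /= andbT; have := @wf_cats _ 8 [:: 11; 10; 0; 4; 5; 6; 7] (fun=> Inc) (nseq kap tt).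
  by rewrite map_nseq; apply.
move/(_ w5 ltac:(by move=> x; ctx_tac)): R5 => R5.
have R6 := reach_clear 0 (R5 _).
have R7 := reach_compile (f := fun x => sem p (registers x) [::]) (R6 _) wp.
have := reach_polytime (R7 _ _ _); apply.
- move=> x; rewrite -[LHS]/(sem (For 10 7 (For 11 7 (cats (nseq kap Inc)))) (upd _ 7 _) (binary 0)).
  rewrite (@sem_count 10 7 (For 11 7 (cats (nseq kap Inc))) _ (side_of (size x) * kap) isT).
    by rewrite upd_same size_nseq addn0.
  move=> s' n s'7.
  rewrite (@sem_count 11 7 (cats (nseq kap Inc)) s' kap isT).
    by rewrite s'7 upd_same size_nseq.
  by move=> s'' m _; apply: sem_incs.
- by move=> x; ctx_tac.
- move=> x; rewrite upd_same; congr (sem p _ _); apply: functional_extensionality => r.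
  rewrite /upd /start.
  by do 10 (case: r => [|r] //).
Qed.

End Registers.

(** * The stable marriage gadget *)

Lemma ordSE n (i : 'I_n) : i.+1 < n -> ordS i = i.+1 :> nat.
Proof. exact: modn_small. Qed.

Lemma ord_predE n (i : 'I_n) : 0 < i -> ord_pred i = i.-1 :> nat.
Proof.
move=> i0; rewrite /= -subn1 -addnBAC // modnDr modn_small ?subn1 //.
by rewrite (leq_ltn_trans (leq_pred _)).
Qed.

Lemma ordS_neq n (i : 'I_n) : 1 < n -> ordS i != i.
Proof.
move=> n1; apply/eqP => /(congr1 val) /=.
have := ltn_ord i; rewrite leq_eqVlt => /orP[/eqP E|lt]; last by rewrite modn_small //; lia.
by rewrite [X in X %% _]E modnn; lia.
Qed.

Lemma ord_pred_neq n (i : 'I_n) : 1 < n -> ord_pred i != i.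
Proof. by move=> n1; rewrite -{2}(ord_predK i) eq_sym ordS_neq. Qed.

Lemma ordS_closed n (P : pred 'I_n) i j : (forall i, P i -> P (ordS i)) -> P i -> P j.
Proof.
move=> cl Pi; have Pit m : P (iter m (@ordS n) i) by elim: m => //= m /cl.
have := Pit (j + (n - i)); congr (P _); apply: val_inj.
have E m : val (iter m (@ordS n) i) = (i + m) %% n.
  elim: m => [|m IH]; first by rewrite addn0 modn_small.
  by rewrite iterS /= -[X in (X.+1 %% _)%N]/(val (iter m (@ordS n) i)) IH -addn1 modnDml addn1 addnS.
rewrite E addnCA subnKC ?modnDr ?modn_small //; exact: ltnW.
Qed.

Section Gadget.

Variables (Z Phi Y : finType) (a b : nat).
Variables (ka : Phi * 'I_a -> Y * 'I_b) (kb : Y * 'I_b -> Phi * 'I_a).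
Variables (sh hs : Phi * 'I_a -> Z -> Z).
Variables (pos : pred 'I_b) (inc : Z -> Phi * 'I_a -> bool).
Hypotheses (kaK : cancel ka kb) (kbK : cancel kb ka).
Hypotheses (shK : forall k, cancel (sh k) (hs k)) (hsK : forall k, cancel (hs k) (sh k)).
Hypotheses (a1 : 1 < a) (b1 : 1 < b).
Hypothesis balanced : \sum_j ~~ pos j = 2 * \sum_j pos j.

(* At every z there are a clause phi for each phi : Phi, a path of men (phi, i) joined by
   covered women, and a variable y for each y : Y, a cycle of men (y, j) alternating
   with covered women.  An uncovered woman (phi, i) links the i-th man of a
   clause to the man [ka (phi, i)] of a cycle at [sh (phi, i) z]; she stands for
   the i-th potential literal of the clause, which really occurs if [inc], and
   is positive if [pos]. *)
Definition gman := (Z * (Phi * 'I_a + Y * 'I_b))%type.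
Definition gwoman := (Z * (Phi * 'I_a + Y * 'I_b + Phi * 'I_a))%type.

Definition pathm z phi i : gman := (z, inl (phi, i)).
Definition cycm z y j : gman := (z, inr (y, j)).
Definition pathw z phi i : gwoman := (z, inl (inl (phi, i))).
Definition cycw z y j : gwoman := (z, inl (inr (y, j))).
Definition litw z k : gwoman := (z, inr k).

Lemma cycw_litw z y j z' k : (cycw z y j == litw z' k) = false.
Proof. exact: andbF. Qed.

Lemma litw_cycw z y j z' k : (litw z' k == cycw z y j) = false.
Proof. exact: andbF. Qed.

Lemma cycw_ordS z y j : (cycw z y (ordS j) == cycw z y j) = false.
Proof. by apply/negbTE/eqP => -[] /eqP; apply/negP; exact: ordS_neq. Qed.

Lemma cycw_ordS' z y j : (cycw z y j == cycw z y (ordS j)) = false.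
Proof. by rewrite eq_sym cycw_ordS. Qed.

Lemma litw_pathw z k z' phi i : (litw z k == pathw z' phi i) = false.
Proof. exact: andbF. Qed.

Lemma pathw_litw z k z' phi i : (pathw z' phi i == litw z k) = false.
Proof. exact: andbF. Qed.

Lemma pathw_ordS z phi i : (pathw z phi (ordS i) == pathw z phi i) = false.
Proof. by apply/negbTE/eqP => -[] /eqP; apply/negP; exact: ordS_neq. Qed.

Definition gwE := (litw_pathw, pathw_litw, pathw_ordS, cycw_litw, litw_cycw, cycw_ordS, cycw_ordS').

Lemma pathm_pred z phi i : (pathm z phi i == pathm z phi (ord_pred i)) = false.
Proof. by rewrite eq_sym; apply/negbTE/eqP => -[] /eqP; apply/negP; exact: ord_pred_neq. Qed.

Lemma cycm_pred z y j : (cycm z y (ord_pred j) == cycm z y j) = false.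
Proof. by apply/negbTE/eqP => -[] /eqP; apply/negP; exact: ord_pred_neq. Qed.

(** In the true orientation of a cycle, man [j] gets [cycw z y j], in the false one the next woman.
    His literal woman is in the middle of his list, so he desires her exactly if he has his last
    choice: in the true orientation at a positive slot, in the false one at a negative slot. *)
Definition gmlist (m : gman) : seq gwoman :=
  match m.2 with
  | inl (phi, i) =>
      litw m.1 (phi, i) :: (if i.+1 < a then [:: pathw m.1 phi (ordS i)] else [::])
      ++ (if 0 < i then [:: pathw m.1 phi i] else [::])
  | inr (y, j) =>
      let l := litw (hs (kb (y, j)) m.1) (kb (y, j)) in
      if pos j then [:: cycw m.1 y (ordS j); l; cycw m.1 y j]
      else [:: cycw m.1 y j; l; cycw m.1 y (ordS j)]
  end.

(** Path woman [i] stands between the men [i - 1] and [i] and prefers the latter, whereas path men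
    prefer the next woman to their own; so no path woman blocks, wherever the free man is. At
    [i = 0] the list is empty and the woman uncovered, as [a] men are joined by [a - 1] women. *)
Definition gwlist (w : gwoman) : seq gman :=
  match w.2 with
  | inl (inl (phi, i)) =>
      if 0 < i then [:: pathm w.1 phi i; pathm w.1 phi (ord_pred i)] else [::]
  | inl (inr (y, j)) => [:: cycm w.1 y (ord_pred j); cycm w.1 y j]
  | inr k =>
      let x := (sh k w.1, inr (ka k)) in
      if inc w.1 k then [:: (w.1, inl k); x] else [:: x; (w.1, inl k)]
  end.

Definition covered (w : Phi * 'I_a + Y * 'I_b + Phi * 'I_a) :=
  match w with inl (inl (_, i)) => 0 < i | inl (inr _) => true | inr _ => false end.

Lemma gmlist_uniq m : uniq (gmlist m).
Proof.
case: m => z [[phi i]|[y j]]; rewrite /gmlist /=; last first.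
  by case: ifP => _; rewrite /= !inE !gwE.
by do 2?case: ifP => _; rewrite /= ?inE ?gwE.
Qed.

Lemma gwlist_uniq w : uniq (gwlist w).
Proof.
case: w => z [[[phi i]|[y j]]|k]; rewrite /gwlist /=.
- by case: ifP => // _; rewrite /= !inE pathm_pred.
- by rewrite /= !inE cycm_pred.
- by case: ifP => _; rewrite /= !inE andbT; apply/eqP.
Qed.

Definition gmarket : smc gman gwoman :=
  Smc gmlist_uniq gwlist_uniq set0 [set w | covered w.2].

Lemma gDelta_W (z : Z) (y : Y) : Delta_W gmarket = 2.
Proof.
apply/eqP; rewrite eqn_leq; apply/andP; split.
  apply/bigmax_leqP => -[z' [[[phi i]|[y' j]]|k]] _; rewrite /= /gwlist //=.
    by case: ifP.
  by case: ifP.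
by apply: (bigmax_sup (cycw z y (Ordinal (ltnW b1)))).
Qed.

Lemma gDelta_M (z : Z) (y : Y) : Delta_M gmarket = 3.
Proof.
apply/eqP; rewrite eqn_leq; apply/andP; split.
  apply/bigmax_leqP => -[z' [[phi i]|[y' j]]] _; rewrite /= /gmlist /=.
    by case: ifP; case: ifP.
  by case: ifP.
apply: (bigmax_sup (cycm z y (Ordinal (ltnW b1)))) => //=.
by rewrite /gmlist /=; case: ifP.
Qed.

Lemma num_blockingE mu : num_blocking gmarket mu =
  \sum_w \sum_(m <- gwlist w) blocking gmarket mu m w.
Proof.
transitivity (\sum_m \sum_w blocking gmarket mu m w).
  rewrite pair_bigA /= /num_blocking -sum1_card big_mkcond /=.
  by apply: eq_bigr => p _; rewrite inE; case: blocking.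
rewrite exchange_big /=; apply: eq_bigr => w _.
rewrite [RHS]big_uniq /=; last exact: gwlist_uniq.
rewrite [RHS]big_mkcond /=; apply: eq_bigr => m _.
by case: ifP => // Bm; rewrite /blocking /acceptable /= Bm andbF.
Qed.

Lemma sum_women (F : gwoman -> nat) : \sum_w F w =
  \sum_z \sum_phi \sum_i F (pathw z phi i) + \sum_z \sum_y \sum_j F (cycw z y j)
  + \sum_z \sum_phi \sum_i F (litw z (phi, i)).
Proof.
transitivity (\sum_z \sum_k F (z, k)); first by rewrite pair_bigA /=; apply: eq_bigr => -[].
rewrite -!big_split /=; apply: eq_bigr => z _.
by rewrite !big_sumType /= !pair_bigA; do 2?congr (_ + _); apply: eq_bigr => -[].
Qed.

(* The man on the cycle then has his least preferred partner. *)
Definition wants tau z k := tau (sh k z) (ka k).1 == pos (ka k).2.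

(** Every slot of every cycle belongs to exactly one literal woman: [(z, k)] and [(sh k z, ka k)]
    correspond bijectively. *)
Lemma sum_wants tau : \sum_z \sum_phi \sum_i wants tau z (phi, i) =
  \sum_z \sum_y \sum_j (tau z y == pos j).
Proof.
under eq_bigr do rewrite pair_bigA /=.
rewrite pair_bigA /=.
under [RHS]eq_bigr do rewrite pair_bigA /=.
rewrite [RHS]pair_bigA /=.
pose f (p : Z * (Phi * 'I_a)) := (sh p.2 p.1, ka p.2).
pose g (p : Z * (Y * 'I_b)) := (hs (kb p.2) p.1, kb p.2).
have fK : cancel f g by move=> [z k]; rewrite /f /g /= kaK shK.
have gK : cancel g f by move=> [z k]; rewrite /f /g /= kbK hsK.
rewrite [RHS](reindex f); last by exists g => p _.
by apply: eq_bigr => -[z [phi i]].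
Qed.

(** For [t] true both sums count the positive slots; for [t] false the first vanishes and the second
    counts the negative slots, twice as many by [balanced]. *)
Lemma sum_cycle (t : bool) :
  \sum_j (t && pos (ord_pred j)) + \sum_j (t == pos j) = 2 * \sum_j pos j.
Proof.
case: t => /=; last first.
  by rewrite big1 // add0n -balanced; apply: eq_bigr => j _; case: pos.
rewrite (reindex (@ordS b)) /=; last by apply: onW_bij; apply: ordS_bij.
rewrite mul2n -addnn; congr (_ + _); apply: eq_bigr => j _.
by rewrite ordSK.
Qed.

Definition satisfied tau := forall z phi, exists i, inc z (phi, i) && wants tau z (phi, i).

(** A clause pays one pair for each of its [a] literal women, minus the two that its free man can
    save. A cycle pays the amount of [sum_cycle], which includes the pairs of its men with literal
    women. *)
Definition gbudget := #|Z| * (#|Phi| * (a - 2) + #|Y| * (2 * \sum_j pos j)).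

Lemma path_total : 2 * (#|Z| * #|Phi|) <= #|Z| * (#|Phi| * a).
Proof. by rewrite [X in _ <= X]mulnA [X in X <= _]mulnC leq_mul2l a1 orbT. Qed.

Lemma gbudgetE : gbudget =
  #|Z| * (#|Phi| * a) - 2 * (#|Z| * #|Phi|) + #|Z| * (#|Y| * (2 * \sum_j pos j)).
Proof. by rewrite /gbudget mulnDr !mulnBr [#|Phi| * 2]mulnC [#|Z| * (2 * _)]mulnCA. Qed.

(* Either orientation of a cycle costs the same: with P positive slots, its cycle women block P times
   in the true one, where moreover P of its men want their literal woman;
   in the false one 2P men do. *)
Lemma cycle_total tau :
  \sum_z \sum_y \sum_j (tau z y && pos (ord_pred j)) +
  \sum_z \sum_phi \sum_i wants tau z (phi, i) = #|Z| * (#|Y| * (2 * \sum_j pos j)).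
Proof.
rewrite sum_wants -big_split /=.
under eq_bigr do rewrite -big_split /=.
under eq_bigr do under eq_bigr do rewrite sum_cycle.
by rewrite !sum_nat_const.
Qed.

Lemma lit_total tau : \sum_z \sum_phi \sum_(i < a) (1 + wants tau z (phi, i)) =
  #|Z| * (#|Phi| * a) + \sum_z \sum_phi \sum_i wants tau z (phi, i).
Proof.
rewrite -sum_nat_const -big_split /=; apply: eq_bigr => z _.
rewrite -sum_nat_const -big_split /=; apply: eq_bigr => phi _.
by rewrite big_split /= sum_nat_const card_ord muln1.
Qed.

Lemma leq_sum_bool (I : finType) (P : pred I) :
  (forall i j, P i -> P j -> i = j) -> \sum_i P i <= 1.
Proof.
move=> H; have -> : \sum_i P i = #|P|.
  by rewrite -sum1_card [RHS]big_mkcond; apply: eq_bigr => i _; rewrite unfold_in; case: (P i).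
by apply/card_le1_eqP => i j Pi Pj; apply: H.
Qed.

(** * From matchings within the budget to satisfying assignments *)

Section FromMatching.

Variable mu : {set gman * gwoman}.
Hypothesis feas : feasible gmarket mu.

Let acc m w : (m, w) \in mu -> (w \in gmlist m) && (m \in gwlist w).
Proof. by case: feas => -[H _] _ _ /H. Qed.

Let injw m w w' : (m, w) \in mu -> (m, w') \in mu -> w = w'.
Proof. by case: feas => -[_ H] _ _ p q; have [] := H _ _ p q (or_introl erefl). Qed.

Let injm m m' w : (m, w) \in mu -> (m', w) \in mu -> m = m'.
Proof. by case: feas => -[_ H] _ _ p q; have [] := H _ _ p q (or_intror erefl). Qed.

Let heldP w : covered w.2 -> exists2 m, m \in gwlist w & (m, w) \in mu.
Proof.
case: feas => _ H _ cw; have := H w; rewrite inE => /(_ cw).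
by rewrite /wpartner; case: pickP => // m mw _; exists m => //; case/andP: (acc mw).
Qed.

Let mpartnerE m w : (m, w) \in mu -> mpartner mu m = Some w.
Proof.
move=> mw; rewrite /mpartner; case: pickP => [w' mw'|/(_ w)]; last by rewrite mw.
by rewrite (injw mw mw').
Qed.

Let wpartnerE m w : (m, w) \in mu -> wpartner mu w = Some m.
Proof.
move=> mw; rewrite /wpartner; case: pickP => [m' mw'|/(_ m)]; last by rewrite mw.
by rewrite (injm mw mw').
Qed.

Let wpartnerN w : (forall m, m \in gwlist w -> (m, w) \notin mu) -> wpartner mu w = None.
Proof.
move=> H; rewrite /wpartner; case: pickP => // m mw.
by have /andP[_ /H] := acc mw; rewrite mw.
Qed.

Definition orientation z y := [exists j, (cycm z y j, cycw z y j) \in mu].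

(** If some man [j] has the woman [j], then the covered woman [j + 1] must take the man [j + 1], and
    so on round the cycle. If none has, every woman takes the man before her. *)
Lemma cycm_held z y j :
  (cycm z y j, if orientation z y then cycw z y j else cycw z y (ordS j)) \in mu.
Proof.
case: ifP => [/existsP[i]|/existsPn H].
  apply: (@ordS_closed b (fun j => (cycm z y j, cycw z y j) \in mu)) => {i j} j jA.
  have [m] := @heldP (cycw z y (ordS j)) isT; rewrite /gwlist /= !inE ordSK.
  move=> /orP[] /eqP-> // jB; have := injw jA jB.
  by move/eqP; rewrite cycw_ordS'.
have [m] := @heldP (cycw z y (ordS j)) isT; rewrite /gwlist /= !inE ordSK.
by move=> /orP[] /eqP-> // jA; have := H (ordS j); rewrite jA.
Qed.

Definition lit_held z k := (((z, inl k) : gman), litw z k) \in mu.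

(** Covering the cycle women uses up all cycle men, so a literal woman can only be matched to her
    clause man. *)
Lemma cyc_litN z y j z' k : (cycm z y j, litw z' k) \notin mu.
Proof.
apply/negP => H; have := cycm_held z y j => /(injw H) /eqP.
by case: ifP => _; rewrite gwE.
Qed.

(** Suppose that men [k < l] both have their literal women. Path woman [k + 1] must then take the
    man [k + 1], the next one the man [k + 2], and so on up to [l], who is already matched. *)
Lemma lit_held_inj z phi i i' : lit_held z (phi, i) -> lit_held z (phi, i') -> i = i'.
Proof.
have no_lt (k l : 'I_a) : k < l -> lit_held z (phi, k) -> lit_held z (phi, l) -> False.
  move=> kl hk hl.
  have H n (na : n < a) : k < n -> n <= l ->
      (pathm z phi (Ordinal na), pathw z phi (Ordinal na)) \in mu.
    elim: n na => // n IH na kn nl.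
    have [m] := @heldP (pathw z phi (Ordinal na)) isT; rewrite /gwlist /= !inE.
    have -> : ord_pred (Ordinal na) = Ordinal (ltnW na).
      by apply: val_inj; apply: ord_predE.
    move=> /orP[] /eqP-> // hn; exfalso.
    have [kn'|nk] := ltnP k n.
      have := injw hn (IH (ltnW na) kn' (ltnW nl)) => /eqP.
      rewrite (_ : Ordinal na = ordS (Ordinal (ltnW na))) ?pathw_ordS //.
      by apply: val_inj; apply/esym/ordSE.
    have kE : Ordinal (ltnW na) = k by apply: val_inj => /=; lia.
    by rewrite kE in hn; have := injw hn hk => /eqP; rewrite gwE.
  have := H l (ltn_ord l) kl (leqnn _); rewrite (_ : Ordinal _ = l); last exact: val_inj.
  by move=> /(injw hl) /eqP; rewrite gwE.
move=> hi hi'; apply: val_inj; case: (ltngtP i i') => // lt.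
  by case: (no_lt _ _ lt hi hi').
by case: (no_lt _ _ lt hi' hi).
Qed.

(** In the true orientation cycle woman [j] has her second choice. Her first choice, the man before
    her, has his last choice if his slot is positive, and she is his first. *)
Lemma blocking_cyc z y j : orientation z y && pos (ord_pred j) ->
  blocking gmarket mu (cycm z y (ord_pred j)) (cycw z y j).
Proof.
move=> /andP[o p]; have := cycm_held z y (ord_pred j); have := cycm_held z y j.
rewrite o => hj hp; rewrite /blocking (mpartnerE hp) (wpartnerE hj).
rewrite /acceptable /prefers /= /gmlist /gwlist /= p ord_predK /= !inE !eqxx /=.
by rewrite cycm_pred -[X in _ && (0 < X)]/(_ : nat) -{1}(ord_predK j) cycw_ordS.
Qed.

Lemma lit_wpartner z k : wpartner mu (litw z k) = if lit_held z k then Some (z, inl k) else None.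
Proof.
case: ifP => h; first exact: wpartnerE.
apply: wpartnerN => m; rewrite /gwlist /=.
have N : ((sh k z, inr (ka k)) : gman, litw z k) \notin mu.
  by case: (ka k) => y j; apply: cyc_litN.
case: ifP => _; rewrite !inE => /orP[] /eqP-> //; by rewrite -/(lit_held z k) h.
Qed.

Lemma blocking_path z k : ~~ lit_held z k ->
  blocking gmarket mu ((z, inl k) : gman) (litw z k).
Proof.
move=> h; rewrite /blocking lit_wpartner (negbTE h) andbT.
apply/andP; split.
  rewrite /acceptable /= /gmlist /gwlist /=; case: k {h} => phi i /=.
  by rewrite mem_head; case: ifP => _; rewrite !inE ?eqxx ?orbT.
rewrite /mpartner; case: pickP => // w mw.
rewrite /prefers /= /gmlist /=; case: k h mw => phi i h mw /=.
by rewrite eqxx; case: eqP => // E; move: h; rewrite /lit_held E mw.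
Qed.

(** The cycle man has his last choice, and the literal woman is either single or, as her literal
    does not occur in the clause, prefers him to her clause man. *)
Lemma blocking_lit z k : wants orientation z k -> ~~ (lit_held z k && inc z k) ->
  blocking gmarket mu ((sh k z, inr (ka k)) : gman) (litw z k).
Proof.
rewrite /wants => w h; rewrite /blocking lit_wpartner.
have hx := cycm_held (sh k z) (ka k).1 (ka k).2.
rewrite (mpartnerE (m := (sh k z, inr (ka k))) (w := if orientation (sh k z) (ka k).1 then
   cycw (sh k z) (ka k).1 (ka k).2 else cycw (sh k z) (ka k).1 (ordS (ka k).2))); last first.
  by move: hx; rewrite /cycm -surjective_pairing.
apply/and3P; split.
- rewrite /acceptable /= /gmlist /gwlist /=.
  case E: (ka k) => [y j] /=; rewrite -E kaK shK.
  by apply/andP; split; case: ifP => _; rewrite !inE ?eqxx ?orbT.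
- rewrite /prefers /= /gmlist /=; case E: (ka k) w => [y j] /= /eqP ->.
  by rewrite -E kaK shK; case: ifP => _ /=; rewrite !gwE !eqxx.
- case: ifP h => //= _ ninc; rewrite /prefers /= /gwlist /= (negbTE ninc) /=.
  by rewrite eqxx; case: eqP.
Qed.

Lemma satisfied_of_matching : num_blocking gmarket mu <= gbudget -> satisfied orientation.
Proof.
rewrite num_blockingE sum_women.
set A := (X in X + _ + _); set B := (X in A + X + _); set C := (X in _ + X) => le.
(* A held literal woman saves the pair with her clause man; a [good] one saves the pair with the
   cycle man as well. *)
pose good z k := [&& lit_held z k, inc z k & wants orientation z k].
have HB : \sum_z \sum_y \sum_j (orientation z y && pos (ord_pred j)) <= B.
  apply: leq_sum => z _; apply: leq_sum => y _; apply: leq_sum => j _.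
  case H: (_ && _) => //; rewrite /gwlist /= big_cons.
  by rewrite blocking_cyc.
have HC : \sum_z \sum_phi \sum_(i < a) (1 + wants orientation z (phi, i)) <=
   C + \sum_z \sum_phi \sum_i (lit_held z (phi, i) + good z (phi, i)).
  rewrite -big_split; apply: leq_sum => z _; rewrite -big_split; apply: leq_sum => phi _.
  rewrite -big_split; apply: leq_sum => i _ /=.
  set k := (phi, i).
  have E : \sum_(m <- gwlist (litw z k)) blocking gmarket mu m (litw z k) =
      blocking gmarket mu (z, inl k) (litw z k) +
      blocking gmarket mu (sh k z, inr (ka k)) (litw z k).
    rewrite /gwlist /=; case: ifP => _; rewrite !big_cons big_nil addn0 //.
    by rewrite addnC.
  rewrite E /good; case h: (lit_held z k) => /=; last first.
    rewrite blocking_path ?h //; case w: (wants _ _ _) => //.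
    by rewrite blocking_lit ?h.
  case w: (wants _ _ _); last by lia.
  case ic: (inc z k) => /=; first by lia.
  by rewrite [X in _ <= _ + nat_of_bool X + _]blocking_lit ?h ?ic //; lia.
have HW := cycle_total orientation.
have HG z phi : \sum_i (lit_held z (phi, i) + good z (phi, i)) <= 1 + [exists i, good z (phi, i)].
  rewrite big_split /=; apply: leq_add.
    by apply: leq_sum_bool => i j; apply: lit_held_inj.
  case: existsP => [_|N].
    by apply: leq_sum_bool => i j /and3P[hi _ _] /and3P[hj _ _]; apply: lit_held_inj hi hj.
  by rewrite big1 // => i _; apply/eqP; rewrite eqb0; apply/negP => g; apply: N; exists i.
have HS : \sum_z \sum_phi \sum_i (lit_held z (phi, i) + good z (phi, i)) <=
   #|Z| * #|Phi| + \sum_z \sum_phi [exists i, good z (phi, i)].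
  rewrite -sum_nat_const -big_split /=; apply: leq_sum => z _.
  rewrite -[#|Phi|]muln1 -sum_nat_const -big_split /=; apply: leq_sum => phi _.
  exact: HG.
(* Meeting the budget requires two savings per clause on average. Holding gives at most one per
   clause, so the good literals must supply one for every clause. *)
have full : #|Z| * #|Phi| <= \sum_z \sum_phi [exists i, good z (phi, i)].
  by move: le HC HS HB HW; rewrite lit_total gbudgetE; have := path_total; lia.
move=> z phi; apply/existsP; move: full; apply: contraTT => N.
rewrite -ltnNge pair_bigA /= -card_prod.
rewrite (bigD1 (z, phi)) //= (_ : [exists i, good z (phi, i)] = false); last first.
  by apply: contraNF N => /existsP[i /and3P[_ ic w]]; apply/existsP; exists i; rewrite ic.
have T0 : 0 < #|{: Z * Phi}| by apply/card_gt0P; exists (z, phi).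
rewrite add0n -(prednK T0) ltnS -(cardC1 (z, phi)) -sum1_card.
by apply: leq_sum => p _; apply: leq_b1.
Qed.

End FromMatching.

Lemma sum2 (T : Type) (F : T -> nat) x y : \sum_(m <- [:: x; y]) F m = F x + F y.
Proof. by rewrite !big_cons big_nil addn0. Qed.

(** * From satisfying assignments to matchings within the budget *)

Section FromAssignment.

Variables (tau : Z -> Y -> bool) (root : Z * Phi -> 'I_a).
Hypothesis rootP : forall z phi,
  inc z (phi, root (z, phi)) && wants tau z (phi, root (z, phi)).

(** The free man of a clause is [root], the position of a true literal: path women up to there take
    the man before them, later ones the man of their own index, and the free man gets his literal
    woman. *)
Definition husband (w : gwoman) : option gman :=
  match w.2 with
  | inl (inl (phi, i)) =>
      if 0 < i then Some (pathm w.1 phi (if i <= root (w.1, phi) then ord_pred i else i))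
      else None
  | inl (inr (y, j)) => Some (cycm w.1 y (if tau w.1 y then j else ord_pred j))
  | inr (phi, i) => if i == root (w.1, phi) then Some (pathm w.1 phi i) else None
  end.

Definition spouse (m : gman) : gwoman :=
  match m.2 with
  | inl (phi, i) =>
      if i == root (m.1, phi) then litw m.1 (phi, i)
      else pathw m.1 phi (if i < root (m.1, phi) then ordS i else i)
  | inr (y, j) => cycw m.1 y (if tau m.1 y then j else ordS j)
  end.

Definition pairing : {set gman * gwoman} := [set p | husband p.2 == Some p.1].

Lemma husband_spouse w m : husband w = Some m -> w = spouse m.
Proof.
case: w => z [[[phi i]|[y j]]|[phi i]]; rewrite /husband /spouse /=.
- case: ifP => // i0 [<-] /=.
  have [le|lt] := leqP i (root (z, phi)).
    have p := ord_predE i0.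
    have -> : (ord_pred i == root (z, phi)) = false.
      by apply/eqP => E; move: p; rewrite E; lia.
    by rewrite p ifT ?ord_predK //; lia.
  by rewrite ifN -?val_eqE ?gtn_eqF // ifN // -leqNgt ltnW.
- by move=> [<-] /=; case: (tau z y); rewrite ?ord_predK.
- by case: ifP => // r [<-] /=; rewrite r.
Qed.

Lemma spouse_husband m : husband (spouse m) = Some m.
Proof.
case: m => z [[phi i]|[y j]]; rewrite /husband /spouse /=; last first.
  by case: (tau z y); rewrite ?ordSK.
case: eqP => [->|/eqP ne] /=; first by rewrite eqxx.
case: (ltnP i (root (z, phi))) => [lt|ge].
  have E : ordS i = i.+1 :> nat by apply: ordSE; exact: leq_ltn_trans lt (ltn_ord _).
  by rewrite E lt /= ordSK.
have lt : root (z, phi) < i.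
  by rewrite ltn_neqAle ge andbT eq_sym; move: ne; rewrite -val_eqE.
by rewrite (leq_ltn_trans _ lt) // leqNgt lt.
Qed.

Lemma pairing_accept m w : husband w = Some m -> acceptable gmarket m w.
Proof.
move=> H; have E := husband_spouse H; move: H; rewrite {}E => _.
case: m => z [[phi i]|[y j]]; rewrite /acceptable /= /gmlist /gwlist /spouse /=.
  case: eqP => [->|/eqP ne] /=.
    by rewrite mem_head; case: ifP => _; rewrite !inE ?eqxx ?orbT.
  case: (ltnP i (root (z, phi))) => [lt|ge].
    have iS : i.+1 < a by exact: leq_ltn_trans lt (ltn_ord _).
    by rewrite ordSE //= iS ordSK !inE !eqxx ?orbT.
  have lt : root (z, phi) < i.
    by rewrite ltn_neqAle ge andbT eq_sym; move: ne; rewrite -val_eqE.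
  have i0 : 0 < i by apply: leq_ltn_trans lt.
  by rewrite i0 mem_head andbT inE mem_cat mem_head !orbT.
by case: (tau z y); case: (pos j); rewrite ?ordSK !inE ?eqxx ?orbT.
Qed.

Lemma wpartner_pairing w : wpartner pairing w = husband w.
Proof.
rewrite /wpartner; case: pickP => [m|N]; first by rewrite inE => /eqP->.
by case E: (husband w) => [m|] //; have := N m; rewrite inE E eqxx.
Qed.

Lemma mpartner_pairing m : mpartner pairing m = Some (spouse m).
Proof.
rewrite /mpartner; case: pickP => [w|/(_ (spouse m))]; rewrite inE.
  by move=> /eqP /husband_spouse /= ->.
by rewrite /= spouse_husband eqxx.
Qed.

Lemma feasible_pairing : feasible gmarket pairing.
Proof.
split.
- split=> [m w|[m w] [m' w']]; rewrite !inE /=.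
    by move=> /eqP /pairing_accept.
  move=> /eqP h /eqP h' [/= E|/= E].
    by rewrite (husband_spouse h) (husband_spouse h') E.
  by move: h; rewrite E h' => -[->].
- move=> w; rewrite inE wpartner_pairing.
  by case: w => z [[[phi i]|[y j]]|[phi i]]; rewrite /husband //= => ->.
- by move=> m; rewrite inE.
Qed.

Lemma blockingE m w : blocking gmarket pairing m w =
  [&& acceptable gmarket m w, prefers (gmlist m) w (spouse m)
    & (if husband w is Some m' then prefers (gwlist w) m m' else true)].
Proof. by rewrite /blocking mpartner_pairing wpartner_pairing. Qed.

Lemma prefers_irr (T : eqType) (l : seq T) x : prefers l x x = false.
Proof. exact: ltnn. Qed.

Lemma prefers_head (T : eqType) (l : seq T) x y : prefers (y :: l) x y = false.
Proof. by rewrite /prefers /= eqxx. Qed.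

Lemma blocking_husband m w : husband w = Some m -> blocking gmarket pairing m w = false.
Proof. by move=> h; rewrite blockingE h prefers_irr !andbF. Qed.

Lemma blocking_pathw z phi i :
  \sum_(m <- gwlist (pathw z phi i)) blocking gmarket pairing m (pathw z phi i) = 0.
Proof.
rewrite /gwlist /=; case: ifP => i0; last by rewrite big_nil.
rewrite sum2.
have [le|lt] := leqP i (root (z, phi)).
  rewrite [X in _ + nat_of_bool X]blocking_husband; last first.
    by rewrite /husband /= i0 le.
  rewrite addn0 blockingE; apply/eqP; rewrite eqb0; apply/negP => /and3P[_ + _].
  rewrite /spouse /=; case: eqP => [E|/eqP ne]; first by rewrite /gmlist /= prefers_head.
  have lt : i < root (z, phi).
    by rewrite ltn_neqAle le andbT; move: ne; rewrite -val_eqE.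
  have iS : i.+1 < a by exact: leq_ltn_trans lt (ltn_ord _).
  by rewrite lt /prefers /gmlist /= iS i0 /= !gwE !eqxx.
rewrite blocking_husband; last by rewrite /husband /= i0 leqNgt lt.
rewrite blockingE /husband /= i0 leqNgt lt /= /gwlist /= i0 prefers_head.
by rewrite !andbF.
Qed.

Lemma blocking_cycw z y j :
  \sum_(m <- gwlist (cycw z y j)) blocking gmarket pairing m (cycw z y j) <=
    tau z y && pos (ord_pred j).
Proof.
rewrite /gwlist sum2.
case t: (tau z y); last first.
  rewrite blocking_husband; last by rewrite /husband /= t.
  by rewrite blockingE /husband /= t /gwlist /= prefers_head !andbF.
rewrite [X in _ + nat_of_bool X]blocking_husband; last by rewrite /husband /= t.
rewrite addn0 /=; case p: (pos _); first exact: leq_b1.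
by rewrite blockingE /spouse /= t /gmlist /= p prefers_head andbF.
Qed.

(** At the root nothing blocks, since she has the clause man, whom she prefers, and the right side
    is 2. Any other literal woman blocks at most once with her clause man, and with the cycle man
    only if he desires her. *)
Lemma blocking_litw z phi i :
  \sum_(m <- gwlist (litw z (phi, i))) blocking gmarket pairing m (litw z (phi, i)) +
    2 * (i == root (z, phi)) <= 1 + wants tau z (phi, i).
Proof.
set k := (phi, i); rewrite /gwlist /=.
have -> : \sum_(m <- if inc z k then [:: (z, inl k); (sh k z, inr (ka k))]
      else [:: (sh k z, inr (ka k)); (z, inl k)]) blocking gmarket pairing m (litw z k) =
    blocking gmarket pairing (z, inl k) (litw z k) +
    blocking gmarket pairing (sh k z, inr (ka k)) (litw z k).
  by case: ifP => _; rewrite sum2 // addnC.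
case: eqP => [E|/eqP ne].
  have /andP[ic w] := rootP z phi; rewrite -E -/k in ic w.
  rewrite w blocking_husband; last by rewrite /husband /k /= E eqxx.
  have h : husband (litw z k) = Some (pathm z phi i) by rewrite /husband /k /= E eqxx.
  by rewrite blockingE h /gwlist /= ic prefers_head !andbF.
rewrite muln0 addn0; apply: leq_add; first exact: leq_b1.
case w: (wants _ _ _); first exact: leq_b1.
rewrite blockingE /spouse /= /gmlist /=; move: w; rewrite /wants.
case: (ka k) => y j /=; case: tau; case: pos => //= _; by rewrite prefers_head andbF.
Qed.

Lemma num_blocking_pairing : num_blocking gmarket pairing <= gbudget.
Proof.
rewrite num_blockingE sum_women.
set A := (X in X + _ + _); set B := (X in A + X + _); set C := (X in _ + X).
have HA : A = 0.
  by rewrite /A; do 3 (rewrite big1 // => ? _); apply: blocking_pathw.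
have HB : B <= \sum_z \sum_y \sum_j (tau z y && pos (ord_pred j)).
  by apply: leq_sum => z _; apply: leq_sum => y _; apply: leq_sum => j _; apply: blocking_cycw.
have HC : C + \sum_z \sum_phi \sum_i 2 * (i == root (z, phi)) <=
   \sum_z \sum_phi \sum_(i < a) (1 + wants tau z (phi, i)).
  rewrite -big_split; apply: leq_sum => z _; rewrite -big_split; apply: leq_sum => phi _.
  by rewrite -big_split; apply: leq_sum => i _; apply: blocking_litw.
have HW := cycle_total tau.
have E2 : \sum_z \sum_phi \sum_i 2 * (i == root (z, phi)) = 2 * (#|Z| * #|Phi|).
  rewrite mulnCA -sum_nat_const; apply: eq_bigr => z _.
  rewrite mulnC -sum_nat_const; apply: eq_bigr => phi _.
  rewrite -big_distrr /= (bigD1 (root (z, phi))) //= eqxx big1 // => i.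
  by move=> /negbTE->.
by move: HA HB HC HW; rewrite lit_total E2 gbudgetE; have := path_total; lia.
Qed.

End FromAssignment.

Lemma gadget : (exists tau, satisfied tau) <->
  exists mu, feasible gmarket mu /\ num_blocking gmarket mu <= gbudget.
Proof.
split=> [[tau sat]|[mu [feas le]]]; last by exists (orientation mu); apply: satisfied_of_matching.
have [root rootP] := fin_all_exists (fun p : Z * Phi => sat p.1 p.2).
have R z phi := rootP (z, phi).
exists (pairing tau root); split; first exact: feasible_pairing.
exact: num_blocking_pairing.
Qed.

End Gadget.

(** * Tableaux of computations as tilings *)

Definition offset : finType := (option bool * bool)%type.

Definition shift1 n (o : option bool) (p : 'I_n) : 'I_n :=
  match o with None => p | Some true => ord_pred p | Some false => ordS p end.

Definition back (o : option bool) := omap negb o.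

Lemma shift1K n o : cancel (@shift1 n o) (shift1 (back o)).
Proof. by case: o => [[]|] p //=; rewrite ?ordSK ?ord_predK. Qed.

Lemma shift1K' n o : cancel (@shift1 n (back o)) (shift1 o).
Proof. by case: o => [[]|] p //=; rewrite ?ordSK ?ord_predK. Qed.

Definition row_shift (up : bool) := if up then Some true else None.

(* Offset [(o, up)]: the row above if [up], in column p, p - 1 or p + 1 as [o] is
   [None], [Some true] or [Some false]; rows and columns are cyclic. *)
Definition shift n (d : offset) (z : 'I_n * 'I_n) : 'I_n * 'I_n :=
  (shift1 (row_shift d.2) z.1, shift1 d.1 z.2).

Definition unshift n (d : offset) (z : 'I_n * 'I_n) : 'I_n * 'I_n :=
  (shift1 (back (row_shift d.2)) z.1, shift1 (back d.1) z.2).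

Lemma shiftK n d : cancel (@shift n d) (unshift d).
Proof. by move=> [t p]; rewrite /shift /unshift /= !shift1K. Qed.

Lemma unshiftK n d : cancel (@unshift n d) (shift d).
Proof. by move=> [t p]; rewrite /shift /unshift /= !shift1K'. Qed.

Section Tableau.

Variable A : tm.
Notation K := (tm_ntapes A).+1.
Notation sym := (symbol (tm_aux A)).

(* A cell of the tableau: the state and the symbols read (the same along a
   row), and for each tape the symbols at distance p to the left and to the
   right of its head. *)
Definition control : finType := (tm_state A * {ffun 'I_K -> option (bool + tm_aux A)})%type.
Definition content : finType :=
  (control * {ffun 'I_K -> option (bool + tm_aux A) * option (bool + tm_aux A)})%type.

Definition control_of (c : config A) : control := (c.1, [ffun i => read (c.2 i)]).

Definition cell (c : config A) i p : sym * sym :=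
  (nth None (c.2 i).1 p, nth None (c.2 i).2 p).

(** A halted machine is made to rewrite what it reads and stay, so that the transition rule also
    covers rows after halting. *)
Definition action (g : control) : tm_state A * {ffun 'I_K -> sym * move} :=
  if tm_delta g.1 g.2 is Some qa then qa else (g.1, [ffun i => (g.2 i, Stay)]).

(** A move shifts the two half-tapes in opposite directions. The flags [p0] and [p1] for 0 < p and 1
    < p single out the cells that receive the written symbol or the symbol crossing to the head. *)
Definition new_cell (sd : sym * move) (p0 p1 : bool) (c cl cr : sym * sym) : sym * sym :=
  match sd.2 with
  | MoveL => (cr.1, if ~~ p0 then c.1 else if ~~ p1 then sd.1 else cl.2)
  | MoveR => (if ~~ p0 then sd.1 else cl.1, cr.2)
  | Stay => (c.1, if ~~ p0 then sd.1 else c.2)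
  end.

Lemma step_state c : (@step A c).1 = (action (control_of c)).1.
Proof. by rewrite /step /Defs.next /action /=; case: tm_delta => [[]|]. Qed.

Lemma step_cell c i p : cell (@step A c) i p =
  new_cell ((action (control_of c)).2 i) (0 < p) (1 < p) (cell c i p)
    (cell c i p.-1) (cell c i p.+1).
Proof.
rewrite /cell /step /Defs.next /action /=; case: tm_delta => [[q a]|] /=.
  rewrite !ffunE /new_cell; case: (a i) => s []; case: (c.2 i) => l r /=.
  - rewrite nth_behead; congr pair.
    by case: p => [|[|p]] //=; rewrite ?nth_behead // nth0.
  - by rewrite nth_behead; case: p.
  - by case: p => [|p] //=; rewrite nth_behead.
by rewrite !ffunE /new_cell /=; case: p => [|p].
Qed.

Definition is_bit (x : sym) := if x is Some (inl _) then true else false.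

Definition here : offset := (None, false).
Definition left : offset := (Some true, false).
Definition above : offset := (None, true).
Definition above_left : offset := (Some true, true).
Definition above_right : offset := (Some false, true).

(* The entries of [f] are the flags [flags t p] defined below. *)
Definition legal (f : seq bool) (g : {ffun offset -> content}) : bool :=
  let: t0 := nth false f 0 in let: tN := nth false f 1 in
  let: p0 := nth false f 2 in let: p1 := nth false f 3 in
  let: pN := nth false f 4 in let: pe := nth false f 5 in
  let: eb := nth false f 6 in let: pb := nth false f 7 in
  let: c := g here in let: lf := g left in let: up := g above in
  let: qa := action up.1 in
  [&& if p0 then c.1 == lf.1 else c.1.2 == [ffun i => (c.2 i).2],
      if t0 then
        (~~ p0 ==> (c.1.1 == qa.1)) &&
        (pN ==> [forall i, c.2 i ==
           new_cell (qa.2 i) p0 p1 (up.2 i) ((g above_left).2 i) ((g above_right).2 i)])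
      else
        (~~ p0 ==> (c.1.1 == tm_start A)) &&
        [forall i, ((c.2 i).1 == None) &&
          (if i == ord0 then
             if pe then (c.2 i).2 == Some (inl eb)
             else if pb then ((c.2 i).2 == None) ||
               (is_bit (c.2 i).2 && (p0 ==> ((lf.2 ord0).2 != None)))
             else (c.2 i).2 == None
           else (c.2 i).2 == None)]
    & [&& t0, ~~ tN & ~~ p0] ==>
        ((up.2 ord0).2 == Some (inl true)) && ~~ is_bit ((g above_right).2 ord0).2].

Lemma leading_bits1 (r : seq sym) : leading_bits r = [:: true] <->
  nth None r 0 = Some (inl true) /\ ~~ is_bit (nth None r 1).
Proof.
case: r => [|[[[]|g]|] [|[[b|g']|] r]] //=;
  split=> //; by do ?case.
Qed.

(** * Legal tilings of the torus are the accepting runs *)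

Section Tiling.

Variables (N B T : nat) (e : seq bool) (F : seq bool -> seq bool).
Hypotheses (eB : size e <= B) (e0 : 0 < size e) (BN : B < N) (TN : T + 2 <= N).
Hypothesis comp : forall w, size w <= B -> computes_within A T w (F w).

(* The row is t and the column p; the certificate ends before column B. *)
Definition flags (t p : nat) : seq bool :=
  [:: 0 < t; t.+1 < N; 0 < p; 1 < p; p.+1 < N; p < size e; nth false e p; p < B].

Lemma iter_output w m : size w <= B -> T <= m -> output (iter m (@step A) (init A w)) = F w.
Proof.
move=> sw Tm; have [H <-] := comp sw; congr output.
rewrite -(subnK Tm); elim: (m - T) => //= k ->.
by rewrite /step H.
Qed.

Lemma init_tape w i p : nth None ((init A w).2 i).2 p =
  if i == ord0 then (if p < size w then Some (inl (nth false w p)) else None) else None.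
Proof.
rewrite /init ffunE; case: eqP => _ /=; last by rewrite nth_nil.
case: ltnP => h; last by rewrite nth_default // size_map.
by rewrite (nth_map false).
Qed.

Lemma init_left w i p : nth None ((init A w).2 i).1 p = None.
Proof. by rewrite /init ffunE; case: eqP => _ /=; rewrite nth_nil. Qed.

Lemma tiling_of_run u : size (e ++ u) <= B -> F (e ++ u) = [:: true] ->
  exists y : 'I_N * 'I_N -> content,
    forall z : 'I_N * 'I_N, legal (flags z.1 z.2) [ffun d => y (shift d z)].
Proof.
move=> sw Fw; set w := e ++ u in sw Fw.
have [run runE] : exists run, forall t, run t = iter t (@step A) (init A w) by eexists.
have [C C1 C2] : exists2 C : nat -> nat -> content,
    forall t p, (C t p).1 = control_of (run t) &
    forall t p i, (C t p).2 i = cell (run t) i p.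
  exists (fun t p => (control_of (run t), [ffun i => cell (run t) i p])) => //= t p i.
  by rewrite ffunE.
exists (fun z : 'I_N * 'I_N => C z.1 z.2) => -[t p].
rewrite /legal !ffunE /= !C1 /shift /=.
have N1 : 1 < N by lia.
have predE (q : 'I_N) : 0 < q -> ((q + N).-1 %% N) = q.-1.
  exact: ord_predE.
have step_at (m : nat) : 0 < m -> run m = step (run m.-1) by case: m => // m; rewrite !runE.
apply/and3P; split.
- case: posnP => [p0|_]; last by rewrite eqxx.
  by apply/eqP/ffunP => i; rewrite !ffunE C2 /= p0 nth0.
- case: posnP => t0.
    have IL i q : nth None ((run 0).2 i).1 q = None by rewrite runE; apply: init_left.
    have IT := init_tape w; rewrite -[init A w]/(iter 0 (@step A) _) -runE in IT.
    rewrite t0; apply/andP; split; first by rewrite runE eqxx implybT.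
    apply/forallP => i; rewrite !C2 /= IL eqxx /= IT.
    case: (i =P ord0) => [_|_]; last by rewrite eqxx.
    rewrite /w size_cat nth_cat.
    case: (ltnP p (size e)) => pe; first by rewrite (leq_trans pe) ?leq_addr.
    case: (ltnP p (size e + size u)) => pw; last by rewrite eqxx if_same.
    have -> : p < B by rewrite (leq_trans pw) // -size_cat.
    have p0 : 0 < p by apply: leq_trans pe.
    rewrite /= p0 /= predE // IT eqxx ifT //.
    by rewrite size_cat; lia.
  have E := step_at _ t0.
  apply/andP; split.
    by apply/implyP => _; rewrite E step_state predE.
  apply/implyP => pN; apply/forallP => i.
  rewrite !C2 E step_cell predE // [p.+1 %% N]modn_small //.
  case: (posnP p) => p0; last by rewrite predE.
  by apply/eqP; rewrite /new_cell p0; case: ((action (control_of (run t.-1))).2 i) => s [].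
(* Only the last row tests the output, namely that of the row above it, which comes after at least
   [T] steps. *)
apply/implyP => /and3P[t0 tN p0].
have -> : nat_of_ord p = 0 by lia.
rewrite predE // [1 %% N]modn_small //.
have Tt : T <= t.-1 by have := ltn_ord t; lia.
have := iter_output sw Tt; rewrite Fw /output -runE => /leading_bits1[h1 h2].
by rewrite !C2 /= h1 eqxx.
Qed.

(** In column 0 the left neighbour is cyclically the last column, about which nothing is known. *)
Lemma new_cell_left sd c cl cl' cr :
  new_cell sd false false c cl cr = new_cell sd false false c cl' cr.
Proof. by case: sd => s []. Qed.

(** Past the prefix [e] a bit may only follow a nonblank cell, so everything from the first blank
    [k] on is blank. Column [B] is blank, whence [k <= B]. *)
Lemma prefix_of_cells (g : nat -> sym) :
  (forall p, p < N -> if p < size e then g p = Some (inl (nth false e p))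
    else if p < B then g p = None \/ is_bit (g p) /\ (0 < p -> g p.-1 != None)
    else g p = None) ->
  exists u, size (e ++ u) <= B /\ forall p, p < N ->
    g p = if p < size (e ++ u) then Some (inl (nth false (e ++ u) p)) else None.
Proof.
move=> H; pose k := find (fun p => g p == None) (iota 0 N).
have gk p : p < k -> g p != None.
  move=> pk; have kN : k <= N by rewrite -[N in _ <= N](size_iota 0 N) find_size.
  by have := before_find 0 pk; rewrite nth_iota ?add0n ?(leq_trans pk) // => ->.
have kB : k <= B.
  rewrite leqNgt; apply/negP => /gk; have := H B BN.
  by rewrite ltnNge eB /= ltnn => ->.
have gkN : g k = None.
  apply/eqP; have : has (fun p => g p == None) (iota 0 N).
    by rewrite has_find size_iota (leq_ltn_trans kB).
  by move=> /(nth_find 0); rewrite nth_iota // (leq_ltn_trans kB).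
have ek : size e <= k.
  rewrite leqNgt; apply/negP => lt; have := H k (leq_ltn_trans kB BN).
  by rewrite lt gkN.
have gN p : k <= p -> p < N -> g p = None.
  elim: p => [|p IH]; first by rewrite leqn0 => /eqP <-.
  rewrite leq_eqVlt => /orP[/eqP <- //|kp] pN.
  have := H p.+1 pN; rewrite ltnNge (leq_trans ek (ltnW kp)) /=.
  case: ifP => // _ [//|[_ /(_ isT)]] /=.
  by rewrite IH // ltnW.
pose w := [seq (if g p is Some (inl b) then b else false) | p <- iota 0 k].
have sw : size w = k by rewrite size_map size_iota.
have wE p : p < k -> g p = Some (inl (nth false w p)).
  move=> pk; rewrite (nth_map 0) ?size_iota // nth_iota // add0n.
  have pB := leq_trans pk kB; have := H p (ltn_trans pB BN); have := gk p pk.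
  by rewrite pB; case: ifP => [_ _ ->//|_]; case: (g p) => [[b|a]|] //= _ [|[]].
have we : take (size e) w = e.
  apply: (@eq_from_nth _ false); first by rewrite size_takel ?sw.
  rewrite size_takel ?sw // => p pe; rewrite nth_take //.
  have pk := leq_trans pe ek; have := wE p pk; have := H p (leq_ltn_trans (leq_trans (ltnW pk) kB) BN).
  by rewrite pe => -> [].
exists (drop (size e) w); rewrite -[X in X ++ _]we cat_take_drop sw; split=> // p pN.
by case: ltnP => [/wE|/gN ->].
Qed.

(* Cells of the last column are unconstrained, so row t agrees with the
   computation only in the columns p < N - t; the last test therefore looks at
   columns 0 and 1 of row N - 2. *)
Lemma run_of_tiling (y : 'I_N * 'I_N -> content) :
  (forall z : 'I_N * 'I_N, legal (flags z.1 z.2) [ffun d => y (shift d z)]) ->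
  exists u, size (e ++ u) <= B /\ F (e ++ u) = [:: true].
Proof.
move=> ok; have N0 : 0 < N by lia.
pose iN k : 'I_N := Ordinal (ltn_pmod k N0).
have [C CE] : exists C, forall t p, C t p = y (iN t, iN p) by eexists.
have pred_iN k : 0 < k -> k < N -> ord_pred (iN k) = iN k.-1.
  move=> k0 kN; have k1 : k.-1 < N by rewrite (leq_ltn_trans (leq_pred k)).
  by apply: val_inj; apply: (etrans (ord_predE _)); rewrite /= !modn_small.
have S_iN k : k.+1 < N -> ordS (iN k) = iN k.+1.
  by move=> kN; apply: val_inj; rewrite /= [k %% N]modn_small // ltnW.
have L t p : t < N -> p < N -> legal (flags t p) [ffun d => y (shift d (iN t, iN p))].
  by move=> tN pN; have := ok (iN t, iN p); rewrite /= !modn_small.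
have bcast t p : t < N -> p < N ->
    if 0 < p then (C t p).1 = (C t p.-1).1
    else (C t p).1.2 = [ffun i => ((C t p).2 i).2].
  move=> tN pN; have /and3P[+ _ _] := L t p tN pN; rewrite !ffunE /shift /= -!CE.
  by case: ifP => p0 /eqP; rewrite ?pred_iN // -?CE.
(* Column 0 contains the state and the symbols under the heads; from there the control is passed
   along the row. *)
have ctl t c : t < N -> (C t 0).1.1 = c.1 -> (forall i, (C t 0).2 i = cell c i 0) ->
    forall p, p < N -> (C t p).1 = control_of c.
  move=> tN c1 c2; elim=> [|p IH] pN.
    have := bcast t 0 tN pN; rewrite /= => E.
    rewrite [LHS]surjective_pairing c1 E; congr pair; apply/ffunP => i.
    by rewrite !ffunE c2 /= nth0.
  by rewrite -IH ?(ltnW pN) //; have := bcast t p.+1 tN pN.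
have row0 p : p < N ->
    ((0 < p) || ((C 0 p).1.1 == tm_start A)) /\
    forall i, ((C 0 p).2 i).1 = None /\
      if i == ord0 then
        if p < size e then ((C 0 p).2 i).2 = Some (inl (nth false e p))
        else if p < B then ((C 0 p).2 i).2 = None \/
          is_bit ((C 0 p).2 i).2 /\ (0 < p -> ((C 0 p.-1).2 ord0).2 != None)
        else ((C 0 p).2 i).2 = None
      else ((C 0 p).2 i).2 = None.
  move=> pN; have /and3P[_ + _] := L 0 p N0 pN; rewrite !ffunE /shift /= -!CE.
  move=> /andP[Q /forallP c]; split; first by move: Q; rewrite implybE negbK.
  move=> i; have /andP[/eqP-> {}c] := c i; split=> //.
  move: c; case: ifP => _; last by move/eqP.
  case: ifP => _; first by move/eqP.
  case: ifP => _; last by move/eqP.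
  move=> /orP[/eqP|/andP[b l]]; [by left|right; split=> // p0].
  by move: l; rewrite p0 /= pred_iN // -CE.
have [|u [uB uE]] := @prefix_of_cells (fun p => ((C 0 p).2 ord0).2).
  by move=> p pN; have [_ /(_ ord0) [_]] := row0 p pN.
exists u; split=> //; set w := e ++ u in uB uE *.
have [run runE] : exists run, forall t, run t = iter t (@step A) (init A w) by eexists.
have cells t : forall p, t + p < N ->
    (C t p).1 = control_of (run t) /\ forall i, (C t p).2 i = cell (run t) i p.
  elim: t => [|t IH].
    have c0 p i : p < N -> (C 0 p).2 i = cell (run 0) i p.
      move=> pN; have [_ /(_ i) [c1 c2]] := row0 p pN.
      rewrite [LHS]surjective_pairing c1 /cell runE init_left init_tape.
      by congr pair; case: eqP c2 => // -> _; rewrite uE.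
    move=> p; rewrite add0n => pN; split; last by move=> i; apply: c0.
    apply: ctl => // [|i]; last exact: c0.
    by have [/eqP-> _] := row0 0 N0; rewrite runE.
  have tr p : t.+1 + p < N -> ((0 < p) || ((C t.+1 p).1.1 == (run t.+1).1)) /\
      forall i, (C t.+1 p).2 i = cell (run t.+1) i p.
    move=> tpN; have tN : t.+1 < N by lia.
    have pN : p.+1 < N by lia.
    have rS : run t.+1 = step (run t) by rewrite !runE.
    have /and3P[_ + _] := L t.+1 p tN (ltnW pN).
    rewrite !ffunE /shift /= !(pred_iN t.+1) // S_iN // -!CE pN /=.
    have [-> c] := IH p ltac:(lia).
    move=> /andP[Q /forallP cs]; split.
      by move: Q; rewrite rS step_state implybE negbK.
    move=> i; have /eqP -> := cs i; rewrite rS step_cell c.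
    have [_ ->] := IH p.+1 ltac:(lia).
    case: (posnP p) => p0; first by rewrite p0; apply: new_cell_left.
    rewrite pred_iN ?(ltnW pN) // -CE.
    by have [_ ->] := IH p.-1 ltac:(lia).
  move=> p tpN; split; last by have [] := tr p tpN.
  apply: ctl; try lia.
    by have [/eqP] := tr 0 ltac:(lia).
  by have [] := tr 0 ltac:(lia).
have tN : N.-1 < N by lia.
have /and3P[_ _] := L N.-1 0 tN N0.
rewrite !ffunE /shift /= !(pred_iN N.-1) ?S_iN -?CE; try lia.
have -> : N.-1.+1 < N = false by lia.
have -> /= : 0 < N.-1 by lia.
have [_ ->] := cells N.-1.-1 0 ltac:(lia).
have [_ ->] := cells N.-1.-1 1 ltac:(lia).
move=> /andP[/eqP h1 h2].
rewrite -(@iter_output w N.-1.-1 uB) ?/output; last by lia.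
by apply/leading_bits1; rewrite -runE.
Qed.

End Tiling.

End Tableau.

(** * Tilings as gadgets *)

Section Constraints.

Variables (Y : finType) (y0 : Y).

(* Every cell has some content ([None]), and no cell sees a forbidden pattern ([Some g]). *)
Definition clause : finType := option {ffun offset -> Y}.

(* Literal kind 0 is positive and 1 negative; kind 2 never occurs in a clause,
   it only doubles the number of negative slots. *)
Definition clause_slot : finType := (offset * Y * 'I_3)%type.
Definition variable_slot : finType := (clause * offset * 'I_3)%type.

Notation ca := #|{: clause_slot}|.
Notation cb := #|{: variable_slot}|.

(** Each clause has a slot for every variable and each variable one for every clause, with the same
    offsets and kinds. Exchanging the two gives the bijection that the gadget asks for. *)
Definition to_variable (k : clause * 'I_ca) : Y * 'I_cb :=
  let: (d, y, s) := enum_val k.2 in (y, enum_rank (k.1, d, s)).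

Definition to_clause (k : Y * 'I_cb) : clause * 'I_ca :=
  let: (phi, d, s) := enum_val k.2 in (phi, enum_rank (d, k.1, s)).

Lemma to_variableK : cancel to_variable to_clause.
Proof.
move=> [phi i]; rewrite /to_variable /to_clause /=; case E: (enum_val i) => [[d y] s] /=.
by rewrite enum_rankK -E enum_valK.
Qed.

Lemma to_clauseK : cancel to_clause to_variable.
Proof.
move=> [y j]; rewrite /to_variable /to_clause /=; case E: (enum_val j) => [[phi d] s] /=.
by rewrite enum_rankK -E enum_valK.
Qed.

Definition slot_offset (k : clause * 'I_ca) : offset := (enum_val k.2).1.1.

Definition positive (j : 'I_cb) := (enum_val j).2 == ord0.

(** The clause of an allowed pattern is kept but becomes a tautology through all positive literals.
    Thus the same clauses exist at every cell, and the constraint enters only through which literals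
    occur. *)
Definition occurs (okg : {ffun offset -> Y} -> bool) (k : clause * 'I_ca) : bool :=
  let: (d, y, s) := enum_val k.2 in
  match k.1 with
  | None => (s == ord0) && (d == here)
  | Some g => if s == ord0 then okg g else (s == inord 1) && (y == g d)
  end.

Lemma ca_gt1 : 1 < ca.
Proof.
rewrite -cardsT; apply/card_gt1P; exists (here, y0, ord0), (here, y0, ord_max).
by split=> //; rewrite xpair_eqE andbF.
Qed.

Lemma cb_gt1 : 1 < cb.
Proof.
rewrite -cardsT; apply/card_gt1P; exists (None, here, ord0), (None, here, ord_max).
by split=> //; rewrite xpair_eqE andbF.
Qed.

Lemma balanced_slots : \sum_(j < cb) ~~ positive j = 2 * \sum_(j < cb) positive j.
Proof.
have E (F : 'I_3 -> nat) : \sum_(j < cb) F (enum_val j).2 =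
    \sum_(p : clause * offset) (F ord0 + F (inord 1) + F (inord 2)).
  rewrite (reindex (@enum_rank _)) /=; last by apply: onW_bij; apply: enum_rank_bij.
  under eq_bigr do rewrite enum_rankK.
  rewrite -(pair_bigA _ (fun _ s => F s)) /=; apply: eq_bigr => p _.
  rewrite !big_ord_recl big_ord0 addn0 addnA; congr (_ + F _ + F _);
  by apply: val_inj; rewrite /= inordK.
rewrite (E (fun s => ~~ (s == ord0))) (E (fun s => s == ord0)) big_distrr /=.
by apply: eq_bigr => p _; rewrite -!val_eqE /= !inordK.
Qed.

Variables (N : nat) (ok : 'I_N * 'I_N -> {ffun offset -> Y} -> bool).

Notation Z := ('I_N * 'I_N)%type.

Lemma satisfied_tiling :
  (exists tau, satisfied to_variable (fun k => shift (slot_offset k)) positive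
     (fun z => occurs (ok z)) tau) <->
  exists y : Z -> Y, forall z, ok z [ffun d => y (shift d z)].
Proof.
split=> [[tau sat]|[y yok]].
  have H z : exists y, tau z y.
    have [i] := sat z None; rewrite /occurs /wants /to_variable /slot_offset /positive /=.
    case E: (enum_val i) => [[d y] s] /=; rewrite enum_rankK /=.
    move=> /andP[/andP[/eqP-> /eqP->]]; rewrite eqxx => /eqP t.
    by exists y; move: t; rewrite /shift /=; case: z.
  (* Several contents may be true at a cell, and any choice works: a forbidden pattern of true
     contents would falsify every literal of its clause. *)
  have [y yP] := fin_all_exists H; exists y => z.
  set g := [ffun d => _]; apply/negPn/negP => nok.
  have [i] := sat z (Some g); rewrite /occurs /wants /to_variable /slot_offset /positive /=.
  case E: (enum_val i) => [[d y'] s] /=; rewrite enum_rankK /=.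
  case: eqP => _; first by rewrite (negbTE nok).
  by move=> /andP[/andP[_ /eqP->]]; rewrite ffunE yP.
exists (fun z y' => y' == y z) => z phi.
have slot (d : offset) (y' : Y) (s : 'I_3) : 
    (match phi with
     | None => (s == ord0) && (d == here)
     | Some g => if s == ord0 then ok z g else (s == inord 1) && (y' == g d)
     end) -> ((y' == y (shift d z)) == (s == ord0)) -> exists i,
  occurs (ok z) (phi, i) && wants to_variable (fun k => shift (slot_offset k)) positive
      (fun z y' => y' == y z) z (phi, i).
  move=> h1 h2; exists (enum_rank (d, y', s)).
  by rewrite /occurs /wants /to_variable /slot_offset /positive /= !enum_rankK /= h1.
case: phi slot => [g|] slot; last first.
  by apply: (slot here (y z) ord0) => //; rewrite /shift /=; case: z {slot} => t p; rewrite !eqxx.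
case okg: (ok z g).
  case t: (g here == y (shift here z)).
    by apply: (slot here (g here) ord0); rewrite ?t ?eqxx ?okg.
  apply: (slot here (g here) (inord 1)); rewrite ?t -?val_eqE /= ?inordK //.
  by rewrite !eqxx.
have [d ne] : exists d, g d != y (shift d z).
  apply/existsP; apply: contraFT okg => /existsPn H.
  rewrite (_ : g = [ffun d => y (shift d z)]) ?yok //.
  by apply/ffunP => d; rewrite ffunE; apply/eqP; have := H d; rewrite negbK.
apply: (slot d (g d) (inord 1)); rewrite ?(negbTE ne) -?val_eqE /= ?inordK //.
by rewrite !eqxx.
Qed.

Definition tiling_market := gmarket to_variable to_clause (fun k => shift (slot_offset k))
  (fun k => unshift (slot_offset k)) positive (fun z : Z => occurs (ok z)) ca_gt1 cb_gt1.

Definition scale := #|clause| * (ca - 2) + #|Y| * (2 * \sum_(j < cb) positive j).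

Lemma tiling_market_yes :
  (exists y : Z -> Y, forall z, ok z [ffun d => y (shift d z)]) <->
  exists mu, feasible tiling_market mu /\ num_blocking tiling_market mu <= N * (N * scale).
Proof.
rewrite -satisfied_tiling.
have -> : N * (N * scale) = #|{: Z}| * scale by rewrite card_prod card_ord mulnA.
apply: gadget.
- exact: to_variableK.
- exact: to_clauseK.
- by move=> k; apply: shiftK.
- by move=> k; apply: unshiftK.
- exact: balanced_slots.
Qed.

End Constraints.

(** * Emitting the encoding *)

Lemma enum_prodE (T1 T2 : finType) :
  enum {: T1 * T2} = [seq (x, y) | x <- enum T1, y <- enum T2].
Proof. by rewrite [LHS]enumT {1}unlock. Qed.

Lemma flatten_enum_prod (T1 T2 : finType) (f : T1 * T2 -> seq bool) :
  flatten [seq f m | m <- enum {: T1 * T2}] =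
  flatten [seq flatten [seq f (x, y) | y <- enum T2] | x <- enum T1].
Proof.
rewrite enum_prodE; elim: (enum T1) => //= x l IH.
by rewrite map_cat flatten_cat IH -map_comp.
Qed.

Lemma emits_for_ord n v w p s (g : 'I_n -> seq bool) : size (s w) = n ->
  (forall i : 'I_n, emits p (upd s v (nseq i true)) (g i)) ->
  emits (For v w p) s (flatten [seq g i | i <- enum 'I_n]).
Proof.
move=> sw H; pose G j := if insub j is Some i then g i else [::].
have -> : [seq g i | i <- enum 'I_n] = [seq G i | i <- iota 0 (size (s w))].
  rewrite sw -val_enum_ord -map_comp; apply: eq_map => i /=.
  by rewrite /G valK.
apply: emits_for => i; rewrite sw => lt.
have -> : G i = g (Ordinal lt) by rewrite /G insubT.
exact: (H (Ordinal lt)).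
Qed.

Lemma emits_skip s : emits Skip s [::].
Proof. by []. Qed.

(** The final [false] makes the numeral self-delimiting, so concatenated numerals can be decoded. *)
Definition unary n := rcons (nseq n true) false.

Lemma unary_inj m n s s' : unary m ++ s = unary n ++ s' -> m = n /\ s = s'.
Proof.
elim: m n => [|m IH] [|n] //=; first by case.
by case=> /IH[-> ->].
Qed.

Definition place_name N (K : finType) (m : 'I_N * 'I_N * K) : seq bool :=
  unary m.1.1 ++ unary m.1.2 ++ unary (enum_rank m.2).

Definition place N (K : Type) (z : 'I_N * 'I_N) (w : option bool * option bool * K) :=
  ((shift1 w.1.1 z.1, shift1 w.1.2 z.2), w.2).

Lemma place_name_inj N (K : finType) : injective (@place_name N K).
Proof.
move=> [[t p] k] [[t' p'] k'] /unary_inj[/val_inj /= -> /unary_inj[/val_inj /= -> E]].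
have := @unary_inj (enum_rank k) (enum_rank k') [::] [::].
by rewrite !cats0 => /(_ E)[/val_inj/enum_rank_inj -> _].
Qed.

(** The contribution of [n] bits [true] to an [enc_str], each preceded by its introducing [true]. *)
Definition marks n := flatten (nseq n [:: true; true]).

Definition put_pred w := For 12 w (Bit 0 12 9 (emit [:: true; true]) Skip).

(** Cyclic wrap-around: the predecessor of 0 is one less than the side, held in register 7, and the
    successor emits no mark once [v] is the last index. *)
Definition put_shift (o : option bool) v :=
  match o with
  | None => For 12 v (emit [:: true; true])
  | Some false => Bit 1 7 v (Cat (emit [:: true; true]) (For 12 v (emit [:: true; true]))) Skip
  | Some true => Bit 0 v 9 (put_pred v) (put_pred 7)
  end.

(* Register 10 holds the row and 11 the column of the current cell, 7 the number of columns. *)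
Definition put_name (oo : option bool * option bool) k :=
  Cat (put_shift oo.1 10) (Cat (emit [:: true; false])
  (Cat (put_shift oo.2 11) (Cat (emit [:: true; false])
  (emit (marks k ++ [:: true; false; false]))))).

(** These are the entries of [flags] in order. Bit number [size v + k] of a unary register is a
    comparison with its length; register 4 yields a bit of the encoded input. *)
Definition tests : seq (nat * nat * nat) :=
  [:: (0, 10, 9); (1, 7, 10); (0, 11, 9); (1, 11, 9); (1, 7, 11); (0, 5, 11); (0, 4, 11); (0, 6, 11)].

(** A decision tree: the flags are known only at run time, so each outcome gets its own copy of the
    code. *)
Fixpoint branch (ts : seq (nat * nat * nat)) (f : seq bool -> cmd) : cmd :=
  match ts with
  | [::] => f [::]
  | (k, r, v) :: ts =>
      Bit k r v (branch ts (fun b => f (true :: b))) (branch ts (fun b => f (false :: b)))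
  end.

Definition outcome (s : store) (ts : nat * nat * nat) :=
  nth false (s ts.1.2) (size (s ts.2) + ts.1.1).

Lemma emits_branch ts f s g : (forall b, emits (f b) s (g b)) ->
  emits (branch ts f) s (g [seq outcome s i | i <- ts]).
Proof.
elim: ts f g => [|[[k r] v] ts IH] f g H //= o.
rewrite [outcome s (k, r, v)]/outcome /=; case: ifP => _.
  by apply: (IH (fun b => f (true :: b)) (fun b => g (true :: b))).
by apply: (IH (fun b => f (false :: b)) (fun b => g (false :: b))).
Qed.

Lemma wf_branch o U ts f : (forall b, wf o U (f b)) ->
  all (fun i => (i.1.2 \in U) && (i.2 \in U)) ts -> wf o U (branch ts f).
Proof.
elim: ts f => [|[[k r] v] ts IH] f H //= /andP[/andP[-> ->] ht] /=.
by rewrite !IH.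
Qed.

Definition put_list (T : Type) (f : T -> cmd) l := Cat (cats [seq Cat (Emit true) (f i) | i <- l]) (Emit false).

Lemma emits_list (T : Type) (f : T -> cmd) g s l : (forall i, emits (f i) s (g i)) ->
  emits (put_list f l) s (enc_seq g l).
Proof.
move=> H; apply: emits_cat; last by [].
apply: (emits_cats (f := fun i => Cat (Emit true) (f i))) => i.
exact: (@emits_cat _ _ _ [:: true]).
Qed.

Definition put_grid (K : finType) (f : K -> cmd) :=
  For 10 7 (For 11 7 (cats [seq f k | k <- enum K])).

Section Output.

Variables (c k c' k' kap : nat) (x : seq bool).
Notation N := (side_of c k c' k' (size x)).
Notation B := (bound_of c k (size x)).

Definition at_cell (t p : nat) :=
  upd (upd (registers c k c' k' kap x) 10 (nseq t true)) 11 (nseq p true).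

Lemma emits_grid (K : finType) (f : K -> cmd) (g : 'I_N * 'I_N * K -> seq bool) :
  (forall (t p : 'I_N) i, emits (f i) (at_cell t p) (g (t, p, i))) ->
  emits (put_grid f) (registers c k c' k' kap x) (flatten [seq g m | m <- enum {: 'I_N * 'I_N * K}]).
Proof.
move=> H; rewrite flatten_enum_prod.
rewrite (flatten_enum_prod (fun z => flatten [seq g (z, i) | i <- enum K])).
apply: emits_for_ord => [|t]; first by rewrite size_nseq.
apply: emits_for_ord => [|p]; first by rewrite size_nseq.
by apply: emits_cats => i; apply: H.
Qed.

Lemma flatten_marks (l : seq nat) : flatten [seq [:: true; true] | _ <- l] = marks (size l).
Proof. exact: flatten_const. Qed.

Lemma emits_marks v s : emits (For 12 v (emit [:: true; true])) s (marks (size (s v))).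
Proof.
rewrite -[X in marks X](size_iota 0) -flatten_marks.
by apply: emits_for => i _; apply: emits_emit.
Qed.

Lemma emits_put_pred w s : w != 12 -> s 9 = [::] -> emits (put_pred w) s (marks (size (s w)).-1).
Proof.
move=> w12 s9.
have -> : marks (size (s w)).-1 =
    flatten [seq if 0 < i then [:: true; true] else [::] | i <- iota 0 (size (s w))].
  case: (size (s w)) => //= n; rewrite -(size_iota 1 n) -flatten_marks.
  congr flatten; rewrite size_iota; apply/eq_in_map => i.
  by rewrite mem_iota => /andP[->].
apply: emits_for => i _; set s' := upd _ _ _.
have := @emits_bit 0 12 9 (emit [:: true; true]) Skip s' [:: true; true] [::]
  (emits_emit _ _) (emits_skip _).
rewrite /s' upd_same upd_other // s9 addn0 nth_nseq.
by case: (0 < i).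
Qed.

Lemma emits_put_shift o v s n (i : 'I_n) : v != 12 -> s v = nseq i true ->
  s 7 = nseq n true -> s 9 = [::] -> emits (put_shift o v) s (marks (shift1 o i)).
Proof.
move=> v12 sv s7 s9; case: o => [[]|] /=.
- have := emits_bit 0 v 9 (emits_put_pred v12 s9) (emits_put_pred (isT : 7 != 12) s9).
  rewrite sv s7 s9 addn0 !size_nseq nth_nseq /=.
  case: posnP => i0 /=; last by rewrite [_ %% _](ord_predE i0).
  rewrite i0 add0n modn_small //.
  by case: n i {sv s7 i0} => // -[].
- have := emits_bit 1 7 v (emits_cat (emits_emit [:: true; true] s) (emits_marks v s))
    (emits_skip s).
  rewrite sv s7 size_nseq addn1 nth_nseq.
  case: ltnP => lt /=; first by rewrite modn_small.
  have -> : i.+1 = n by apply/eqP; rewrite eqn_leq lt ltn_ord.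
  by rewrite modnn.
- by have := emits_marks v s; rewrite sv size_nseq.
Qed.

Lemma enc_str_cat y z : enc_str (y ++ z) = flatten [seq [:: true; b] | b <- y] ++ enc_str z.
Proof. by rewrite enc_strE map_cat flatten_cat -catA. Qed.

Lemma enc_unary n : flatten [seq [:: true; b] | b <- unary n] = marks n ++ [:: true; false].
Proof.
rewrite /unary /marks -cats1 map_cat flatten_cat; congr cat.
by elim: n => //= n ->.
Qed.

Lemma emits_put_name (K : finType) (t p : 'I_N) (w : option bool * option bool * K) :
  emits (put_name w.1 (enum_rank w.2)) (at_cell t p) (enc_str (place_name (place (t, p) w))).
Proof.
rewrite /place_name !enc_str_cat !enc_unary /= -!catA.
have s7 : at_cell t p 7 = nseq N true by [].
have s9 : at_cell t p 9 = [::] by [].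
apply: emits_cat; first exact: (emits_put_shift _ (n := N)).
apply: emits_cat; first exact: emits_emit.
apply: emits_cat; first exact: (emits_put_shift _ (n := N)).
apply: emits_cat; first exact: emits_emit.
rewrite -[unary _]cats0 enc_str_cat enc_unary -catA.
exact: emits_emit.
Qed.

Lemma outcomes (t p : 'I_N) :
  [seq outcome (at_cell t p) i | i <- tests] = flags N B (enc_str x) t p.
Proof.
have T m j : nth false (nseq m true) j = (j < m) by rewrite nth_nseq; case: ltnP.
transitivity [:: nth false (nseq t true) (0 + 0); nth false (nseq N true) (size (nseq t true) + 1);
  nth false (nseq p true) (0 + 0); nth false (nseq p true) (0 + 1);
  nth false (nseq N true) (size (nseq p true) + 1);
  nth false (nseq (size x).*2.+1 true) (size (nseq p true) + 0);
  nth false (enc_str x) (size (nseq p true) + 0);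
  nth false (nseq B true) (size (nseq p true) + 0)]; first by [].
by rewrite !T !size_nseq !addn0 !addn1 -size_enc_str.
Qed.

End Output.

(** * The reduction *)

Section Instance.

Variables (Y : finType) (y0 : Y) (lg : seq bool -> {ffun offset -> Y} -> bool).

Notation ca := #|{: clause_slot Y}|.
Notation cb := #|{: variable_slot Y}|.

Definition man_kind : finType := (clause Y * 'I_ca + Y * 'I_cb)%type.
Definition woman_kind : finType := (clause Y * 'I_ca + Y * 'I_cb + clause Y * 'I_ca)%type.

(* The triple of a row shift, a column shift and a kind names a person of a nearby cell. *)
Definition relative_mlist (m : man_kind) : seq (option bool * option bool * woman_kind) :=
  match m with
  | inl (phi, i) =>
      (None, None, inr (phi, i)) ::
      (if i.+1 < ca then [:: (None, None, inl (inl (phi, ordS i)))] else [::])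
      ++ (if 0 < i then [:: (None, None, inl (inl (phi, i)))] else [::])
  | inr (y, j) =>
      let q := to_clause (y, j) in
      let l := (back (row_shift (slot_offset q).2), back (slot_offset q).1, inr q) in
      if positive j then [:: (None, None, inl (inr (y, ordS j))); l; (None, None, inl (inr (y, j)))]
      else [:: (None, None, inl (inr (y, j))); l; (None, None, inl (inr (y, ordS j)))]
  end.

Definition relative_wlist (f : seq bool) (w : woman_kind) :
    seq (option bool * option bool * man_kind) :=
  match w with
  | inl (inl (phi, i)) =>
      if 0 < i then [:: (None, None, inl (phi, i)); (None, None, inl (phi, ord_pred i))]
      else [::]
  | inl (inr (y, j)) => [:: (None, None, inr (y, ord_pred j)); (None, None, inr (y, j))]
  | inr k =>
      let x := (row_shift (slot_offset k).2, (slot_offset k).1, inr (to_variable k)) in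
      if occurs (lg f) k then [:: (None, None, inl k); x] else [:: x; (None, None, inl k)]
  end.

Definition put_member (K : finType) (w : option bool * option bool * K) :=
  put_name w.1 (enum_rank w.2).

Definition own (K : finType) (k : K) : option bool * option bool * K := (None, None, k).

Definition put_men := Cat (put_grid (fun m : man_kind => Cat (Emit true)
  (Cat (put_member (own m)) (put_list (@put_member _) (relative_mlist m))))) (Emit false).

Definition put_women := Cat (put_grid (fun w : woman_kind => Cat (Emit true)
  (Cat (put_member (own w)) (branch tests (fun f =>
    put_list (@put_member _) (relative_wlist f w)))))) (Emit false).

Definition put_covered := Cat (put_grid (fun w : woman_kind =>
  if covered w then Cat (Emit true) (put_member (own w)) else Skip)) (Emit false).

Definition put_budget :=
  Cat (For 10 8 (Cat (Emit true) (Bit 0 8 10 (Emit true) (Emit false)))) (Emit false).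

Definition put_input :=
  Cat put_men (Cat put_women (Cat (Emit false) (Cat put_covered put_budget))).

Lemma wf_put_member (K : finType) (w : option bool * option bool * K) :
  wf 0 [:: 11; 10; 4; 5; 6; 7; 8; 9] (put_member w).
Proof. by rewrite /put_member; case: w => [[[[]|] [[]|]] k] /=; rewrite !wf_emit. Qed.

Lemma wf_put_list (T : Type) o U (f : T -> cmd) l :
  (forall i, wf o U (f i)) -> wf o U (put_list f l).
Proof. by move=> H; rewrite /= andbT; apply: wf_cats => i; apply: H. Qed.

Lemma wf_put_grid (K : finType) (f : K -> cmd) :
  (forall i, wf 0 [:: 11; 10; 4; 5; 6; 7; 8; 9] (f i)) ->
  wf 0 [:: 4; 5; 6; 7; 8; 9] (put_grid f).
Proof. by move=> H; rewrite /= wf_cats. Qed.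

Lemma wf_cat o U p q : wf o U p -> wf o U q -> wf o U (Cat p q).
Proof. by move=> wp wq; apply/andP. Qed.

Lemma wf_put_input : wf 0 [:: 4; 5; 6; 7; 8; 9] put_input.
Proof.
apply: wf_cat; last (apply: wf_cat; last (apply: wf_cat => //; apply: wf_cat => //));
  apply: wf_cat => //; apply: wf_put_grid => i.
- apply: wf_cat => //; apply: wf_cat; first exact: wf_put_member.
  by apply: wf_put_list => j; apply: wf_put_member.
- apply: wf_cat => //; apply: wf_cat; first exact: wf_put_member.
  by apply: wf_branch => // b; apply: wf_put_list => j; apply: wf_put_member.
- by case: ifP => // _; apply: wf_cat => //; apply: wf_put_member.
Qed.

Variables (c k c' k' : nat) (x : seq bool).
Notation N := (side_of c k c' k' (size x)).
Notation B := (bound_of c k (size x)).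
Notation kap := (scale Y).

Definition input_ok (z : 'I_N * 'I_N) := lg (flags N B (enc_str x) z.1 z.2).

Definition input : smc_input :=
  @SmcInput _ _ (tiling_market y0 input_ok)
    (@place_name N man_kind) (@place_name N woman_kind)
    (@place_name_inj N man_kind) (@place_name_inj N woman_kind) (N * (N * kap)).

Lemma mlist_place z m : mlist (market input) (z, m) = map (place z) (relative_mlist m).
Proof.
case: z m => t p [[phi i]|[y j]] /=; rewrite /gmlist /=.
  by rewrite map_cat; do 2 case: ifP.
by case: ifP.
Qed.

(** Up to translation the lists depend on the cell only through its flags, which is what lets one
    loop body emit all of them. *)
Lemma wlist_place z w : wlist (market input) (z, w) =
  map (place z) (relative_wlist (flags N B (enc_str x) z.1 z.2) w).
Proof.
case: z w => t p [[[phi i]|[y j]]|q] /=; rewrite /gwlist //=.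
  by case: ifP.
by rewrite /input_ok /=; case: ifP.
Qed.

Lemma emits_member (K : finType) (t p : 'I_N) (w : option bool * option bool * K) :
  emits (put_member w) (at_cell c k c' k' kap x t p) (enc_str (place_name (place (t, p) w))).
Proof. exact: emits_put_name. Qed.

Lemma enc_seq_map (T1 T2 : Type) (e : T2 -> seq bool) (f : T1 -> T2) l :
  enc_seq e (map f l) = enc_seq (fun i => e (f i)) l.
Proof. by rewrite /enc_seq -map_comp. Qed.

Lemma emits_input : emits put_input (registers c k c' k' kap x) (enc_smc input).
Proof.
have grid (K : finType) (f : K -> cmd) (g : 'I_N * 'I_N * K -> seq bool) :
    (forall (t p : 'I_N) i, emits (f i) (at_cell c k c' k' kap x t p) (g (t, p, i))) ->
    emits (Cat (put_grid f) (Emit false)) (registers c k c' k' kap x)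
      (flatten [seq g m | m <- enum {: 'I_N * 'I_N * K}] ++ [:: false]).
  by move=> H; apply: emits_cat (emits_grid H) _.
apply: emits_cat.
  apply: grid => t p m; apply: (@emits_cat _ _ _ [:: true]) => //.
  apply: emits_cat; first exact: (emits_member t p (own m)).
  by rewrite mlist_place enc_seq_map; apply: emits_list => w; apply: emits_member.
apply: emits_cat.
  apply: grid => t p w; apply: (@emits_cat _ _ _ [:: true]) => //.
  apply: emits_cat; first exact: (emits_member t p (own w)).
  rewrite wlist_place -(outcomes kap); pose em (m : men input) := enc_str (mname m).
  apply: (@emits_branch tests _ _
    (fun f => enc_seq em (map (place (t, p)) (relative_wlist f w)))) => f.
  by rewrite enc_seq_map; apply: emits_list => m; apply: emits_member.
rewrite /= enum_set0; apply: (@emits_cat _ _ _ [:: false]) => //.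
apply: emits_cat.
  rewrite /enc_seq.
  set W := flatten _.
  have -> : W = flatten [seq if covered w.2 then true :: enc_str (place_name w) else [::]
      | w <- enum {: 'I_N * 'I_N * woman_kind}].
    have -> : W = flatten [seq true :: enc_str (place_name w)
        | w <- [seq w <- enum {: 'I_N * 'I_N * woman_kind} | covered w.2]].
      by congr (flatten (map _ _)); rewrite enumT; apply: eq_filter => w; rewrite /= inE.
    by elim: (enum _) => //= w l IH; case: ifP => _ //=; rewrite IH.
  apply: grid => t p w /=; case: ifP => _ //.
  by apply: (@emits_cat _ _ _ [:: true]) => //; apply: (emits_member t p (own w)).
rewrite enc_strE; apply: emits_cat => //.
set b := binary _.
have s8 : registers c k c' k' kap x 8 = b by [].
have -> : flatten [seq [:: true; i] | i <- b] =
    flatten [seq [:: true; nth false b i] | i <- iota 0 (size (registers c k c' k' kap x 8))].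
  by rewrite s8 -{1}(mkseq_nth false b) /mkseq -map_comp; congr flatten; apply: eq_map.
apply: emits_for => i _; apply: (@emits_cat _ _ _ [:: true] [:: _]) => // o /=.
by rewrite upd_same upd_other // size_nseq addn0 s8; case: nth.
Qed.

End Instance.

Lemma polytime_input (Y : finType) (y0 : Y) lg c k c' k' :
  polytime (fun x => enc_smc (input y0 lg c k c' k' x)).
Proof.
have [A [a [b H]]] := polytime_cmd c k c' k' (scale Y) (wf_put_input lg).
exists A, a, b => x; have := H x.
by rewrite (emits_input y0 lg c k c' k' x) cats0.
Qed.

Theorem theorem9 :
  NP_hard enc_smc
    (fun I : smc_input =>
       [/\ mstar (market I) = set0, Delta_W (market I) = 2
         & Delta_M (market I) = 3])
    smc_yes.
Proof.
move=> L [V [c [k [[g [[A [c' [k' comp]]] VE]] LE]]]].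
pose y0 : content A := ((tm_start A, [ffun=> None]), [ffun=> (None, None)]).
exists (input y0 (@legal A) c k c' k'); split; first exact: polytime_input.
  move=> x; set N := side_of c k c' k' (size x).
  have N0 : 0 < N by rewrite /N /side_of addn3.
  have z : 'I_N * 'I_N := (Ordinal N0, Ordinal N0).
  by split=> //; [apply: gDelta_W z y0 | apply: gDelta_M z y0].
move=> x; set n := size x; set N := side_of c k c' k' n; set B := bound_of c k n.
(* The verifier's time bound at length [B], valid for all its inputs of at most that length because
   a halted machine stays as it is. *)
pose T := c' * B ^ k' + c'.
have comp' w : size w <= B -> computes_within A T w (g w).
  move=> sw; have [H <-] := comp w; have tT : c' * size w ^ k' + c' <= T.
    rewrite /T leq_add2r leq_mul2l; case: (k') => [|m]; first by rewrite !expn0 orbT.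
    by rewrite leq_exp2r // sw orbT.
  by rewrite /computes_within (halted_iter H tT).
have sx : size (enc_str x) = n.*2.+1 by apply: size_enc_str.
have tiles := tiling_market_yes y0 (@input_ok _ (@legal A) c k c' k' x).
have eB : size (enc_str x) <= B by rewrite sx /B /bound_of leq_addr.
have e0 : 0 < size (enc_str x) by rewrite sx.
have BN : B < N by rewrite /N /side_of -/B -/T; lia.
have TN : T + 2 <= N by rewrite /N /side_of -/B -/T; lia.
rewrite LE; split=> [[u [su Vu]]|/tiles[y ok]].
  apply/tiles.
  apply: (tiling_of_run eB e0 BN TN comp' (u := u)); last by apply/VE.
  by rewrite size_cat sx /B /bound_of leq_add2l.
have [u [su gu]] := run_of_tiling eB e0 BN TN comp' ok.
exists u; split; last by apply/VE.
by move: su; rewrite size_cat sx /B /bound_of leq_add2l.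
Qed.
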